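(* Let $(M,\varphi,\xi,\eta,g,\alpha,\beta,c)$ be a Lorentzian trans-Sasakian space form, where $\alpha,\beta$ are constants and the constant $c$ is the $\varphi$-sectional curvature. Then the curvature tensor $R$ of $M$ satisfies, for all vector fields $X,Y,Z$, $$\begin{aligned}4R(X,Y)Z={}&[3(\alpha^2-\beta^2)-c]\,[g(X,Z)Y-g(Y,Z)X]\\&+(\alpha^2-\beta^2+c)\,[\eta(Z)\{\eta(Y)X-\eta(X)Y\}+\{\eta(Y)g(X,Z)-\eta(X)g(Y,Z)\}\xi\\&\qquad+g(X,\varphi Z)\varphi Y-g(Y,\varphi Z)\varphi X+2g(X,\varphi Y)\varphi Z]\\&+8\alpha\beta\,[\{\eta(X)g(Y,\varphi Z)-\eta(Y)g(X,\varphi Z)\}\xi+\eta(Z)\{\eta(X)\varphi Y-\eta(Y)\varphi X\}].\end{aligned}$$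
   Context: A $(2n+1)$-dimensional manifold $M$ has an almost contact structure $(\varphi,\xi,\eta)$ if it carries a vector field $\xi$, a $(1,1)$-tensor field $\varphi$ and a 1-form $\eta$ with $\eta(\xi)=1$, $\varphi^2=-I+\eta\otimes\xi$, $\varphi(\xi)=0$, $\eta\circ\varphi=0$. A Lorentzian metric $g$ (nondegenerate symmetric $(0,2)$-tensor of index 1) is compatible if $g(\varphi X,\varphi Y)=g(X,Y)+\eta(X)\eta(Y)$; then $g(X,\xi)=-\eta(X)$, $g(\xi,\xi)=-1$, $g(X,\varphi Y)=-g(\varphi X,Y)$, and $(M,\varphi,\xi,\eta,g)$ is called a Lorentzian almost contact metric manifold. It is a Lorentzian trans-Sasakian manifold $(M,\varphi,\xi,\eta,g,\alpha,\beta)$ if, with $\nabla$ the Levi-Civita connection of $g$ and $\alpha,\beta$ smooth functions on $M$, $$(\nabla_X\varphi)Y=\alpha[\eta(Y)X+g(X,Y)\xi]-\beta[\eta(Y)\varphi X+g(\varphi X,Y)\xi],$$ $$\nabla_X\xi=\alpha\varphi X+\beta(X-\eta(X)\xi),\qquad (\nabla_X\eta)Y=\alpha g(X,\varphi Y)-\beta g(\varphi X,\varphi Y).$$ The curvature convention is $R(X,Y)Z=\nabla_X\nabla_YZ-\nabla_Y\nabla_XZ-\nabla_{[X,Y]}Z$ and $R(X,Y,Z,W)=g(R(X,Y)Z,W)$. A Lorentzian trans-Sasakian space form is a Lorentzian trans-Sasakian manifold of constant $\varphi$-holomorphic sectional curvature $c$, i.e. $R(X,\varphi X,X,\varphi X)=-c\,g(X,X)^2$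 for every vector field $X$ orthogonal to $\xi$. *)

(* Defs.v *)
From HB Require Import structures.
From mathcomp Require Import all_boot all_order all_algebra.
From mathcomp Require Import all_classical all_reals all_analysis.
From mathcomp Require Import ring.
Set Implicit Arguments.
Unset Strict Implicit.
Unset Printing Implicit Defensive.
Import Order.TTheory GRing.Theory Num.Theory numFieldNormedType.Exports.
Local Open Scope classical_set_scope.
Local Open Scope ring_scope.

Section Smooth.
Context {R : realType} {m : nat}.
Implicit Types (U : set 'rV[R]_m) (f g : 'rV[R]_m -> R).

(* Only used for U open, where the partial derivatives at a point of U do not  *)
(* depend on the values of f outside U.                                       *)
Fixpoint Ck (k : nat) U f : Prop :=
  {within U, continuous f} /\
  if k is k'.+1 then
    forall i : 'I_m, (forall x, U x -> derivable f x (delta_mx 0 i)) /\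
                     Ck k' U (fun x => 'D_(delta_mx 0 i) f x)
  else True.

Definition smooth_on U f : Prop := forall k, Ck k U f.

Lemma eq_Ck k U f g : open U -> (forall x, U x -> f x = g x) ->
  Ck k U f -> Ck k U g.
Proof.
move=> oU; have cE f' g' : (forall x, U x -> f' x = g' x) ->
    {within U, continuous f'} -> {within U, continuous g'}.
  by move=> fg; apply: subspace_eq_continuous => x /set_mem /fg.
have nE f' g' x : (forall x, U x -> f' x = g' x) -> U x ->
    \forall y \near x, f' y = g' y :> R.
  move=> fg Ux; apply: filterS (open_nbhs_nbhs (conj oU Ux)); exact: fg.
elim: k f g => [|k IH] f g fg /= [cf df]; split=> //; try exact: cE cf.
move=> i; have [d1 d2] := df i; split.
  by move=> x Ux; apply: near_eq_derivable (d1 x Ux); exact: nE.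
apply: IH d2 => x Ux; apply: near_eq_derive; exact: nE.
Qed.

Lemma Ck_leS k U f : Ck k.+1 U f -> Ck k U f.
Proof.
by elim: k f => [|k IH] f [cf df]; split=> // i; have [d1 d2] := df i;
  split=> //; exact: IH.
Qed.

Lemma Ck_cst k U (a : R) : open U -> Ck k U (cst a).
Proof.
move=> oU; have cc (b : R) : {within U, continuous (cst b : 'rV[R]_m -> R)}.
  by apply: continuous_subspaceT => x; exact: cst_continuous.
elim: k a => [|k IH] a; split=> // i; split=> [x _|]; first exact: derivable_cst.
by apply: eq_Ck (IH 0) => // x _; rewrite derive_cst.
Qed.

Lemma CkD k U f g : open U -> Ck k U f -> Ck k U g ->
  Ck k U (fun x => f x + g x).
Proof.
move=> oU.
elim: k f g => [|k IH] f g /= [cf df] [cg dg]; split=> //;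
  try by move=> x; apply: continuousD; [exact: cf|exact: cg].
move=> i; have [f1 f2] := df i; have [g1 g2] := dg i; split.
  by move=> x Ux; apply: derivableD; [exact: f1|exact: g1].
apply: eq_Ck (IH _ _ f2 g2) => // x Ux.
by rewrite deriveD //; [exact: f1|exact: g1].
Qed.

Lemma CkM k U f g : open U -> Ck k U f -> Ck k U g ->
  Ck k U (fun x => f x * g x).
Proof.
move=> oU.
elim: k f g => [|k IH] f g; first move=> [cf _] [cg _].
  by split=> // x; apply: continuousM; [exact: cf|exact: cg].
move=> Cf Cg; have [f' g'] := (Ck_leS Cf, Ck_leS Cg).
move: Cf Cg => [cf df] [cg dg]; split.
  by move=> x; apply: continuousM; [exact: cf|exact: cg].
move=> i; have [f1 f2] := df i; have [g1 g2] := dg i; split.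
  by move=> x Ux; apply: derivableM; [exact: f1|exact: g1].
apply: eq_Ck (CkD oU (IH _ _ f' g2) (IH _ _ g' f2)) => // x Ux.
by rewrite deriveM //; [exact: f1|exact: g1].
Qed.

End Smooth.

Record chart (R : realType) (m : nat) (T : topologicalType) := Chart {
  chart_dom : set T;
  chart_codom : set 'rV[R]_m;
  chart_fun : T -> 'rV[R]_m;
  chart_inv : 'rV[R]_m -> T;
  chart_dom_open : open chart_dom;
  chart_codom_open : open chart_codom;
  chart_funP : forall p, chart_dom p -> chart_codom (chart_fun p);
  chart_invP : forall x, chart_codom x -> chart_dom (chart_inv x);
  chart_funK : forall p, chart_dom p -> chart_inv (chart_fun p) = p;
  chart_invK : forall x, chart_codom x -> chart_fun (chart_inv x) = x;
  chart_fun_continuous : {within chart_dom, continuous chart_fun};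
  chart_inv_continuous : {within chart_codom, continuous chart_inv} }.

Definition smooth_transition R m T (c d : chart R m T) : Prop :=
  forall i : 'I_m,
    smooth_on (chart_codom c `&` chart_inv c @^-1` chart_dom d)
              (fun x => chart_fun d (chart_inv c x) 0 i).

(* The atlas is not required to be maximal: a compatible larger atlas has the *)
(* same smooth functions.                                                     *)
Record smoothManifold (R : realType) (m : nat) := SmoothManifold {
  manifold_space :> topologicalType;
  atlas : set (chart R m manifold_space);
  manifold_hausdorff : hausdorff_space manifold_space;
  manifold_second_countable : @second_countable manifold_space;
  atlas_cover : forall p, exists2 c, atlas c & chart_dom c p;
  atlas_compatible : forall c d, atlas c -> atlas d -> smooth_transition c d }.

Section SmoothFunctions.
Context {R : realType} {m : nat} (M : smoothManifold R m).

Definition smooth (f : M -> R) : Prop :=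
  forall c, atlas c -> smooth_on (chart_codom c) (f \o chart_inv c).

Definition smooth_pred : {pred M -> R} := fun f => `[< smooth f >].

Fact smooth_subring : subring_closed smooth_pred.
Proof.
have oc (c : chart R m M) := @chart_codom_open _ _ _ c.
split=> [|f g /asboolP sf /asboolP sg|f g /asboolP sf /asboolP sg];
  apply/asboolP => c ac k.
- exact: Ck_cst.
- apply: (@eq_Ck _ _ _ _ (fun x => f (chart_inv c x)
                                   + -1 * g (chart_inv c x))) => //.
    by move=> x _ /=; rewrite mulN1r.
  apply: CkD => //; first exact: sf.
  by apply: CkM => //; [exact: Ck_cst|exact: sg].
- by apply: CkM => //; [exact: sf|exact: sg].
Qed.
HB.instance Definition _ :=
  GRing.isSubringClosed.Build (M -> R) smooth_pred smooth_subring.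

Record smoothFun := SmoothFun {
  smooth_val :> M -> R; smooth_valP : smooth_val \in smooth_pred }.
HB.instance Definition _ := [isSub for smooth_val].
HB.instance Definition _ := [Choice of smoothFun by <:].
HB.instance Definition _ := 
  GRing.SubChoice_isSubComPzRing.Build (M -> R) smooth_pred smoothFun
    smooth_subring.

Definition mk_smooth (f : M -> R) (sf : smooth f) : smoothFun :=
  SmoothFun (asboolT sf).

Fact smooth_cst (a : R) : smooth (fun=> a).
Proof. by move=> c _ k; apply: Ck_cst; exact: (@chart_codom_open _ _ _ c). Qed.

(* Scalars of R act on smooth functions through the constant functions.       *)
Definition cstC (a : R) : smoothFun := mk_smooth (smooth_cst a).

Lemma smoothP (f : smoothFun) : smooth f.
Proof. exact/asboolP/(smooth_valP f). Qed.

Lemma smoothFunP (f g : smoothFun) : (forall p, f p = g p) -> f = g.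
Proof. by move=> fg; apply: val_inj; apply/funext. Qed.

End SmoothFunctions.

(* Tangent vectors are derivations at a point; a vector field is a section p  *)
(* |-> X_p of the tangent bundle such that p |-> X_p f is smooth for every    *)
(* smooth f, which is the same data as a derivation f |-> X f of the ring of  *)
(* smooth functions, with (X f)(p) = X_p f.                                   *)
Section Tangent.
Context {R : realType} {m : nat} (M : smoothManifold R m).
Local Notation C := (smoothFun M).

Section AtPoint.
Variable p : M.

Definition is_point_derivation (v : C -> R) : Prop :=
  [/\ forall f g, v (f + g) = v f + v g,
      forall a f, v (cstC M a * f) = a * v f &
      forall f g, v (f * g) = f p * v g + g p * v f].

Definition point_derivation : {pred C -> R^o} :=
  fun v => `[< is_point_derivation v >].

Fact point_derivation_submod : submod_closed point_derivation.
Proof.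
split=> [|a u v /asboolP[uD uZ uM] /asboolP[vD vZ vM]]; apply/asboolP.
  by split=> *; rewrite /= ?mulr0 ?addr0.
have E f : (a *: u + v) f = a * u f + v f by [].
split=> [f g|b f|f g]; rewrite !E.
- by rewrite uD vD mulrDr addrACA.
- by rewrite uZ vZ mulrDr mulrCA.
- by rewrite uM vM !mulrDr addrACA !(mulrCA a).
Qed.
HB.instance Definition _ :=
  GRing.isSubmodClosed.Build R (C -> R^o) point_derivation
    point_derivation_submod.

Record tangent := Tangent {
  tangent_val :> C -> R^o;
  tangent_valP : tangent_val \in point_derivation }.
HB.instance Definition _ := [isSub for tangent_val].
HB.instance Definition _ := [Choice of tangent by <:].
HB.instance Definition _ := [SubChoice_isSubLmodule of tangent by <:].

Lemma tangentP (v : tangent) : is_point_derivation v.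
Proof. exact/asboolP/(tangent_valP v). Qed.

End AtPoint.

Definition is_derivation (D : C -> C) : Prop :=
  [/\ forall f g, D (f + g) = D f + D g,
      forall a f, D (cstC M a * f) = cstC M a * D f &
      forall f g, D (f * g) = f * D g + g * D f].

Definition derivation : {pred C -> C^o} := fun D => `[< is_derivation D >].

Fact derivation_submod : submod_closed derivation.
Proof.
split=> [|a u v /asboolP[uD uZ uM] /asboolP[vD vZ vM]]; apply/asboolP.
  by split=> *; rewrite /= ?mulr0 ?addr0.
have E f : (a *: u + v) f = a * u f + v f by [].
split=> [f g|b f|f g]; rewrite !E.
- by rewrite uD vD mulrDr addrACA.
- by rewrite uZ vZ mulrDr mulrCA.
- by rewrite uM vM !mulrDr addrACA !(mulrCA a).
Qed.
HB.instance Definition _ :=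
  GRing.isSubmodClosed.Build C (C -> C^o) derivation derivation_submod.

Record vectorField := VectorField {
  field_val :> C -> C^o;
  field_valP : field_val \in derivation }.
HB.instance Definition _ := [isSub for field_val].
HB.instance Definition _ := [Choice of vectorField by <:].
HB.instance Definition _ := [SubChoice_isSubLmodule of vectorField by <:].

Lemma vectorFieldP (X : vectorField) : is_derivation X.
Proof. exact/asboolP/(field_valP X). Qed.

Fact field_at_subproof (X : vectorField) p :
  (fun f => X f p) \in point_derivation p.
Proof.
by have [XD XZ XM] := vectorFieldP X; apply/asboolP; split=> *;
  rewrite ?XD ?XZ ?XM.
Qed.

Definition field_at (X : vectorField) (p : M) : tangent p :=
  Tangent (field_at_subproof X p).

Section MkField.
Variables (v : forall p, tangent p).
Hypothesis sv : forall f : C, smooth (fun p => v p f).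

Fact mk_field_subproof : (fun f => mk_smooth (sv f)) \in derivation.
Proof.
by apply/asboolP; split=> [f g|a f|f g]; apply: smoothFunP => p /=;
  have [vD vZ vM] := tangentP (v p); rewrite ?vD ?vZ ?vM.
Qed.

Definition mk_field : vectorField := VectorField mk_field_subproof.

End MkField.

Fact lie_bracket_subproof (X Y : vectorField) :
  (fun f => X (Y f) - Y (X f)) \in derivation.
Proof.
have [[XD XZ XM] [YD YZ YM]] := (vectorFieldP X, vectorFieldP Y).
apply/asboolP; split=> [f g|a f|f g].
- by rewrite YD XD XD YD opprD addrACA.
- by rewrite YZ XZ XZ YZ mulrBr.
- by rewrite YM XM XD YD !XM !YM; ring.
Qed.

Definition lie_bracket (X Y : vectorField) : vectorField :=
  VectorField (lie_bracket_subproof X Y).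

End Tangent.

Section Tensors.
Context {R : realType} {m : nat} (M : smoothManifold R m).
Local Notation C := (smoothFun M).
Local Notation VF := (vectorField M).

Record oneForm := OneForm {
  form_at : forall p : M, {linear tangent p -> R^o};
  form_smooth : forall X : VF, smooth (fun p => form_at p (field_at X p)) }.

Definition form_app (w : oneForm) (X : VF) : C := mk_smooth (form_smooth w X).

Record tensor11 := Tensor11 {
  endo_at : forall p : M, {linear tangent p -> tangent p};
  endo_smooth : forall (X : VF) (f : C),
    smooth (fun p => endo_at p (field_at X p) f) }.

Definition endo_app (T : tensor11) (X : VF) : VF :=
  mk_field (endo_smooth T X).

Record metric := Metric {
  metric_at : forall p : M, tangent p -> tangent p -> R;
  metric_linear : forall p (a : R) (u v w : tangent p),
    metric_at (a *: u + v) w = a * metric_at u w + metric_at v w;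
  metric_sym : forall p (u v : tangent p), metric_at u v = metric_at v u;
  metric_nondegenerate : forall p (u : tangent p),
    (forall v, metric_at u v = 0) -> u = 0;
  metric_smooth : forall X Y : VF,
    smooth (fun p => metric_at (field_at X p) (field_at Y p)) }.

Definition metric_app (g : metric) (X Y : VF) : C :=
  mk_smooth (metric_smooth g X Y).

End Tensors.

Coercion form_app : oneForm >-> Funclass.
Coercion endo_app : tensor11 >-> Funclass.
Coercion metric_app : metric >-> Funclass.

Section Index.
Context {R : realType} {V : lmodType R} (B : V -> V -> R).

(* Such a family is linearly independent, so this says that B is negative     *)
(* definite on the k-dimensional span of v.                                   *)
Definition negative_family k (v : 'I_k -> V) : Prop :=
  forall c : 'I_k -> R, (exists i, c i != 0) ->
    B (\sum_i c i *: v i) (\sum_i c i *: v i) < 0.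

Definition has_index k : Prop :=
  (exists v : 'I_k -> V, negative_family v) /\
  ~ (exists v : 'I_k.+1 -> V, negative_family v).

End Index.

Definition lorentzian R m (M : smoothManifold R m) (g : metric M) : Prop :=
  forall p : M, has_index (@metric_at _ _ _ g p) 1.

Section Connection.
Context {R : realType} {m : nat} {M : smoothManifold R m}.
Local Notation C := (smoothFun M).
Local Notation VF := (vectorField M).
Implicit Types (nabla : VF -> VF -> VF) (g : metric M) (X Y Z W : VF) (f : C).

Record levi_civita g nabla : Prop := LeviCivita {
  nabla_linear : forall f X Y Z,
    nabla (f *: X + Y) Z = f *: nabla X Z + nabla Y Z;
  nablaD : forall X Y Z, nabla X (Y + Z) = nabla X Y + nabla X Z;
  nabla_leibniz : forall f X Y, nabla X (f *: Y) = X f *: Y + f *: nabla X Y;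
  nabla_torsion_free : forall X Y, nabla X Y - nabla Y X = lie_bracket X Y;
  nabla_metric : forall X Y Z,
    X (g Y Z) = g (nabla X Y) Z + g Y (nabla X Z) }.

Definition nabla_endo nabla (phi : tensor11 M) X Y : VF :=
  nabla X (phi Y) - phi (nabla X Y).

Definition nabla_form nabla (eta : oneForm M) X Y : C :=
  X (eta Y) - eta (nabla X Y).

Definition curvature nabla X Y Z : VF :=
  nabla X (nabla Y Z) - nabla Y (nabla X Z) - nabla (lie_bracket X Y) Z.

Definition curvature4 g nabla X Y Z W : C := g (curvature nabla X Y Z) W.

End Connection.

Section TransSasakian.
Context {R : realType} {m : nat} {M : smoothManifold R m}.
Local Notation C := (smoothFun M).
Local Notation VF := (vectorField M).
Variables (phi : tensor11 M) (xi : VF) (eta : oneForm M) (g : metric M).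

Record almost_contact : Prop := AlmostContact {
  eta_xi : eta xi = 1;
  phi_sqr : forall X : VF, phi (phi X) = - X + eta X *: xi;
  phi_xi : phi xi = 0;
  eta_phi : forall X : VF, eta (phi X) = 0 }.

Record lorentzian_almost_contact_metric : Prop :=
  LorentzianAlmostContactMetric {
    lacm_almost_contact : almost_contact;
    lacm_lorentzian : lorentzian g;
    lacm_compatible : forall X Y : VF,
      g (phi X) (phi Y) = g X Y + eta X * eta Y }.

Variable nabla : VF -> VF -> VF.

Record lorentzian_trans_sasakian (alpha beta : C) : Prop :=
  LorentzianTransSasakian {
    lts_almost_contact_metric : lorentzian_almost_contact_metric;
    lts_levi_civita : levi_civita g nabla;
    lts_phi : forall X Y : VF,
      nabla_endo nabla phi X Y =
        alpha *: (eta Y *: X + g X Y *: xi)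
        - beta *: (eta Y *: phi X + g (phi X) Y *: xi);
    lts_xi : forall X : VF,
      nabla X xi = alpha *: phi X + beta *: (X - eta X *: xi);
    lts_eta : forall X Y : VF,
      nabla_form nabla eta X Y =
        alpha * g X (phi Y) - beta * g (phi X) (phi Y) }.

Definition constant_phi_sectional_curvature (c : R) : Prop :=
  forall X : VF, g X xi = 0 ->
    curvature4 g nabla X (phi X) X (phi X) = - (cstC M c * g X X ^+ 2).

Record lorentzian_trans_sasakian_space_form (alpha beta : C) (c : R) : Prop :=
  LorentzianTransSasakianSpaceForm {
    ltssf_trans_sasakian : lorentzian_trans_sasakian alpha beta;
    ltssf_curvature : constant_phi_sectional_curvature c }.

End TransSasakian.

(* Main.v *)
Require Import Defs.
From HB Require Import structures.
From mathcomp Require Import all_boot all_order all_algebra.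
From mathcomp Require Import all_classical all_reals all_analysis.
From mathcomp Require Import ring.
Import Order.TTheory GRing.Theory Num.Theory numFieldNormedType.Exports.
Local Open Scope classical_set_scope.
Local Open Scope ring_scope.
Set Implicit Arguments.
Unset Strict Implicit.
Unset Printing Implicit Defensive.

(** The curvature is determined by three facts.  Differentiating the formula
    for nabla xi gives R(X,Y)xi explicitly ([curvature_xi]).  Differentiating
    the formula for nabla phi gives the commutator of R(X,Y) with phi
    ([curvature_phi]).  The value of g(R(X,phi X)X, phi X) for X orthogonal to
    xi is the space form hypothesis.  The right-hand side of the theorem
    satisfies the same three identities, so the difference of the two sides,
    the quadrilinear form [defect], has the symmetries of a curvature tensor,
    vanishes as soon as an argument is xi, is invariant under phi in its last
    two arguments, and vanishes on all (X, phi X, X, phi X).  The classical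
    polarization argument for Kaehler curvature tensors
    ([holomorphic_sectional_eq0]) then gives defect = 0.

    The term in alpha * beta fits this picture because it is zero: the first
    Bianchi identity applied to (X, xi, Z, xi) in the formula for R(X,Y)xi
    gives 4 alpha beta g(phi X, Z) = 0, so with constant alpha and beta either
    alpha = 0, or beta = 0, or phi = 0 ([trans_sasakian_degenerate]).

    All of this takes place after pairing with a vector field W, that is, in
    the commutative ring of smooth functions.  Coming back to an equality of
    vector fields requires that a field orthogonal to all vector fields is
    zero ([metric_app_inj]).  Nondegeneracy of the metric is a statement about
    tangent vectors at a point, defined as derivations, so every such
    derivation has to be the value of a global vector field
    ([tangent_extension]).  In a chart around p, let h be a bump function,
    extended by zero to M; this uses the chain rule [Ck_comp] to compare
    charts, and the Hausdorff property.  Hadamard's lemma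
    f = f(p) + sum_i (x_i - a_i) G_i, multiplied by h^2, becomes an identity
    of globally defined smooth functions, and a derivation v at p turns it
    into h(p)^2 v(f) = sum_i v(h (x_i - a_i)) h(p) d_i f(p).  So v is the
    value at p of a combination of the global fields h d_i. *)

(** * Differentiable and smooth functions of several variables *)

Section Calculus.
Context {R : realType} {m : nat}.
Implicit Types (U V : set 'rV[R]_m) (F : 'rV[R]_m -> R).

Local Notation e_ i := (delta_mx 0 i : 'rV[R]_m).

Lemma within_open (T U : topologicalType) (A : set T) (f : T -> U) : open A ->
  {within A, continuous f} <-> forall x, A x -> {for x, continuous f}.
Proof.
move=> oA; rewrite continuous_open_subspace//; split=> H x.
  by move=> Ax; apply: H; rewrite inE.
by rewrite inE; exact: H.
Qed.

Lemma Ck0P U F : open U ->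
  (forall x, U x -> {for x, continuous F}) -> Ck 0 U F.
Proof. by move=> oU H; split=> //; apply/within_open. Qed.

Lemma Ck_continuous k U F x : open U -> Ck k U F -> U x ->
  {for x, continuous F}.
Proof. by move=> oU; case: k => [|k] [/(within_open _ oU) H _]; exact: H. Qed.

Lemma Ck_sub k U V F : open U -> open V -> V `<=` U -> Ck k U F -> Ck k V F.
Proof.
move=> oU oV VU; elim: k F => [|k IH] F /= [cF dF].
  by split=> //; apply: continuous_subspaceW cF.
split; first exact: continuous_subspaceW cF.
by move=> i; have [d1 d2] := dF i; split=> [x /VU|]; [exact: d1|exact: IH].
Qed.

Lemma Ck_le k l U F : (k <= l)%N -> Ck l U F -> Ck k U F.
Proof.
move=> /subnK <-; elim: (l - k)%N => // i IH; rewrite addSn => /Ck_leS; exact: IH.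
Qed.

Lemma Ck_local k U F : open U ->
  (forall x, U x -> exists V, [/\ open V, V x & Ck k V F]) -> Ck k U F.
Proof.
move=> oU; elim: k F => [|k IH] F H.
  apply: Ck0P => // x Ux; have [V [oV Vx CF]] := H x Ux.
  exact: Ck_continuous CF Vx.
split.
  apply/within_open => // x Ux; have [V [oV Vx CF]] := H x Ux.
  exact: Ck_continuous CF Vx.
move=> i; split=> [x Ux|].
  by have [V [oV Vx [_ /(_ i)[d1 _]]]] := H x Ux; exact: d1.
apply: IH => x Ux; have [V [oV Vx [_ /(_ i)[_ d2]]]] := H x Ux.
by exists V.
Qed.

Lemma Ck_sum k U (I : Type) (s : seq I) (f : I -> 'rV[R]_m -> R) : open U ->
  (forall i, Ck k U (f i)) -> Ck k U (fun x => \sum_(i <- s) f i x).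
Proof.
move=> oU Cf; elim: s => [|i s IH].
  by apply: (eq_Ck oU _ (Ck_cst k 0 oU)) => x _; rewrite big_nil.
by apply: (eq_Ck oU _ (CkD oU (Cf i) IH)) => x _; rewrite big_cons.
Qed.

Lemma continuous_rV (n : nat) (T : topologicalType) (f : T -> 'rV[R]_n) (t : T) :
  (forall j, {for t, continuous (fun s => f s 0 j)}) -> {for t, continuous f}.
Proof.
move=> H; apply/cvg_ballP => e e0.
have : \forall s \near t, forall j, ball (f t 0 j) e (f s 0 j).
  by apply: filter_forall => j; move/cvg_ballP: (H j) => /(_ e e0).
by apply: filterS => s Hs; split=> // i j; rewrite ord1.
Qed.

Lemma coord_le_norm (h : 'rV[R]_m) j : `|h 0 j| <= `|h|.
Proof.
rewrite [leRHS]/Num.Def.normr/= mx_normrE; apply/bigmax_geP; right => /=.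
by exists (ord0, j).
Qed.

(** The sign of b is arbitrary, which spares a case distinction on the sign of
    each coordinate of an increment. *)
Lemma MVT_from0 (f df : R -> R) (b : R) :
  (forall s : R, `|s| <= `|b| -> is_derive s 1 f (df s)) ->
  exists2 s, `|s| <= `|b| & f b - f 0 = df s * b.
Proof.
move=> H; have [b0|b0] := leP 0 b.
  have Hs s : s \in `[0, b] -> `|s| <= `|b|.
    by rewrite in_itv/= => /andP[s0 sb]; rewrite !ger0_norm.
  have [| |s sb E] := @MVT_segment R f df 0 b b0.
  - by move=> s sb; apply: H; apply: Hs; apply: subset_itv_oo_cc.
  - by apply: derivable_within_continuous => s /Hs /H [].
  by exists s; [exact: Hs|rewrite E subr0].
have Hs s : s \in `[b, 0] -> `|s| <= `|b|.
  by rewrite in_itv/= => /andP[s0 sb]; rewrite !ler0_norm ?lerN2// ltW.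
have [| |s sb E] := @MVT_segment R f df b 0 (ltW b0).
- by move=> s sb; apply: H; apply: Hs; apply: subset_itv_oo_cc.
- by apply: derivable_within_continuous => s /Hs /H [].
by exists s; [exact: Hs|rewrite -opprB E sub0r mulrN opprK].
Qed.

Lemma is_derive_line F (z v : 'rV[R]_m) (s : R) :
  derivable F (s *: v + z) v ->
  is_derive s 1 (fun t : R => F (t *: v + z)) ('D_v F (s *: v + z)).
Proof.
have E : (fun h : R => h^-1 *: (F (h *: v + (s *: v + z)) - F (s *: v + z))) =
    (fun h : R => h^-1 *: (((fun t : R => F (t *: v + z)) \o shift s) (h *: 1)
                     - F (s *: v + z))).
  by apply/funext => h /=; rewrite addrA -scalerDl [h%:A]mulr1.
move=> dF; split; first by rewrite /derivable -E.
by rewrite /derive -E.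
Qed.

(** The increment from x to h + x is split into steps parallel to the axes,
    the mean value theorem is applied to each of them, and continuity of the
    partial derivatives makes the intermediate points harmless. *)
Lemma C1_differentiable U F x : open U -> Ck 1 U F -> U x ->
  differentiable F x.
Proof.
move=> oU CF Ux.
pose df (h : 'rV[R]_m) : R := \sum_i h 0 i * 'D_(e_ i) F x.
have dfL : linear df.
  move=> a u v; rewrite /df scaler_sumr -big_split/=; apply: eq_bigr => i _.
  by rewrite !mxE mulrDl scalerAl.
pose dfl : {linear 'rV[R]_m -> R} :=
    HB.pack df (GRing.isLinear.Build _ _ _ _ df dfL).
have dF1 i z : U z -> derivable F z (e_ i).
  by move=> Uz; have [_ /(_ i)[d1 _]] := CF; exact: d1.
have est : forall eps : R, 0 < eps ->
  \forall h \near (0 : 'rV[R]_m), `|F (h + x) - (F x + df h)| <= eps * `|h|.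
  move=> eps eps0; pose d := eps / m.+1%:R.
  (* each of the m steps contributes an error of at most d * `|h| *)
  have d0 : 0 < d by rewrite divr_gt0.
  have /nbhs_ballP[r /= r0 Hr] : \forall z \near x, U z /\
      forall i, `|'D_(e_ i) F z - 'D_(e_ i) F x| <= d.
    have UU : \forall z \near x, U z by exact: open_nbhs_nbhs.
    have DD : \forall z \near x, forall i, `|'D_(e_ i) F z - 'D_(e_ i) F x| <= d.
      refine (@filter_forall _ _
        (fun i z => `|'D_(e_ i) F z - 'D_(e_ i) F x| <= d) (nbhs x) _ _) => i.
      have [_ /(_ i)[_ CD]] := CF.
      have /cvgrPdist_le/(_ d d0) := @Ck_continuous 0 _ _ _ oU CD Ux.
      by apply: filterS => z; rewrite distrC.
    by apply: filterS2 UU DD => z Uz Dz; split.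
  apply/nbhs_ballP; exists r => // h /= [_ hr].
  have {}hr j : `|h 0 j| < r.
    by have := hr 0 j; rewrite /ball/= mxE sub0r normrN.
  (* h truncated to its first k coordinates *)
  pose hk (k : nat) : 'rV[R]_m := \row_j (if (j < k)%N then h 0 j else 0).
  have key k : (k <= m)%N ->
      `|F (hk k + x) - (F x + \sum_(j < m | (j < k)%N) h 0 j * 'D_(e_ j) F x)|
      <= k%:R * d * `|h|.
    elim: k => [_|k IH km].
      rewrite big_pred0 // addr0 mul0r mul0r
        (_ : hk 0%N = 0) ?add0r ?subrr ?normr0//.
      by apply/rowP => j; rewrite !mxE.
    pose i := Ordinal km.
    have hkS : hk k.+1 = h 0 i *: e_ i + hk k.
      apply/rowP => j; rewrite !mxE eqxx/= ltnS leq_eqVlt.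
      have [->|ji] := eqVneq j i; first by rewrite eqxx ltnn mulr1 addr0.
      by rewrite (_ : (j == k :> nat) = false) ?mulr0 ?add0r//; apply/negbTE.
    have bl s : `|s| <= `|h 0 i| -> ball x r (s *: e_ i + (hk k + x)).
      move=> sh; split=> // a j; rewrite ord1 /ball/= !mxE eqxx/=.
      have [->|ji] := eqVneq j i.
        by rewrite ltnn mulr1 add0r distrC addrK (le_lt_trans sh).
      rewrite mulr0 add0r distrC addrK; case: ifP => // _.
      by rewrite normr0.
    have [s sh Es] := @MVT_from0 (fun t => F (t *: e_ i + (hk k + x)))
      (fun t => 'D_(e_ i) F (t *: e_ i + (hk k + x))) (h 0 i)
      (fun s sh => is_derive_line (dF1 i _ (Hr _ (bl s sh)).1)).
    rewrite scale0r add0r in Es.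
    rewrite hkS -addrA (bigD1 i)//=.
    rewrite (eq_bigl (fun j : 'I_m => (j < k)%N)); last first.
      move=> j; rewrite ltnS leq_eqVlt -(inj_eq val_inj)/=.
      by case: ltngtP.
    have := IH (ltnW km); set S := \sum_(_ < _ | _) _ => IHk.
    rewrite (_ : _ - _ = (F (hk k + x) - (F x + S)) +
      ('D_(e_ i) F (s *: e_ i + (hk k + x)) - 'D_(e_ i) F x) * h 0 i); last first.
      by rewrite mulrBl -Es; ring.
    have -> : k.+1%:R * d * `|h| = k%:R * d * `|h| + d * `|h|.
      by rewrite -natr1; ring.
    rewrite (le_trans (ler_normD _ _))// lerD// normrM.
    apply: ler_pM => //; last exact: coord_le_norm.
    by have [_] := Hr _ (bl s sh); apply.
  have := key m (leqnn m).
  rewrite (_ : hk m = h); last by apply/rowP => j; rewrite mxE ltn_ord.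
  rewrite (eq_bigl xpredT); last by move=> j; rewrite ltn_ord.
  move=> /le_trans; apply; apply: ler_wpM2r => //.
  by rewrite /d mulrCA ger_pMr// ler_pdivrMr ?mul1r ?ler_nat.
have cdf : continuous dfl.
  move=> h; pose D i (y : 'rV[R]_m) : R := y 0 i * 'D_(e_ i) F x.
  refine (@cvg_big R _ +%R 0 xpredT (@add_continuous _) _ (nbhs h) _ D _ _ _).
  move=> i _.
  by apply: cvgMr_tmp; exact: coord_continuous.
have E : F \o shift x = cst (F x) + dfl +o_ (0 : 'rV[R]_m) id.
  apply/eqaddoP => eps eps0; near=> h.
  by near: h; exact: est.
by apply/diff_locallyP; rewrite (diff_unique cdf E); split.
Unshelve. all: by end_near.
Qed.

Lemma is_derive_curve F (ga : R -> 'rV[R]_m) (t : R) :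
  (forall i, derivable (fun s => ga s 0 i) t 1) -> differentiable F (ga t) ->
  is_derive t 1 (F \o ga)
    (\sum_i 'D_(e_ i) F (ga t) * 'D_1 (fun s => ga s 0 i) t).
Proof.
move=> dga dF.
have dg : derivable ga t 1 by apply/derivable_mxP => a j; rewrite ord1.
have Dg : differentiable ga t by apply/derivable1_diffP.
split; first by apply/derivable1_diffP; exact: differentiable_comp.
have -> : 'D_1 (F \o ga) t = 'd F (ga t) ('D_1 ga t).
  rewrite (deriveE _ Dg) deriveE; last exact: differentiable_comp.
  by rewrite diff_comp.
rewrite derive_mx// [X in 'd _ _ X]row_sum_delta linear_sum/=.
by apply: eq_bigr => i _; rewrite linearZ/= !mxE (deriveE _ dF) mulrC.
Qed.

End Calculus.

Lemma is_derive_comp_dir {R : realType} {n m : nat} (ta : 'rV[R]_n -> 'rV[R]_m)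
    (F : 'rV[R]_m -> R) (x v : 'rV[R]_n) :
  (forall j, derivable (fun y => ta y 0 j) x v) -> differentiable F (ta x) ->
  is_derive x v (F \o ta)
    (\sum_j 'D_(delta_mx 0 j) F (ta x) * 'D_v (fun y => ta y 0 j) x).
Proof.
move=> dta dF.
have L (G : 'rV[R]_n -> R) : derivable G x v ->
    is_derive (0 : R) 1 (fun s : R => G (s *: v + x)) ('D_v G x).
  move=> dG; have := @is_derive_line R n G x v (0 : R).
  by rewrite scale0r add0r; apply.
have H j : derivable (fun s : R => ta (s *: v + x) 0 j) 0 1.
  by have [] := L _ (dta j).
have := @is_derive_curve R m F (fun s : R => ta (s *: v + x)) 0 H.
rewrite scale0r add0r => /(_ dF)[].
move=> d1 E; have d2 : derivable (F \o ta) x v by apply/derivable1P; exact: d1.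
split=> //; rewrite (eq_bigr (fun j => 'D_(delta_mx 0 j) F (ta x) *
    'D_1 (fun s : R => ta (s *: v + x) 0 j) 0)); last first.
  by move=> j _; congr (_ * _); have [_ ->] := L _ (dta j).
by rewrite -E; have [_ <-] := L _ d2.
Qed.

(** By induction on k: the partial derivatives of a composite are sums of
    products of a composite and a partial derivative. *)
Lemma Ck_comp {R : realType} {n m : nat} k (U : set 'rV[R]_n) (V : set 'rV[R]_m)
    (ta : 'rV[R]_n -> 'rV[R]_m) (F : 'rV[R]_m -> R) :
  open U -> open V -> (forall x, U x -> V (ta x)) ->
  (forall j, Ck k U (fun x => ta x 0 j)) -> Ck k V F -> Ck k U (F \o ta).
Proof.
move=> oU oV UV.
have cta k' : (forall j, Ck k' U (fun x => ta x 0 j)) ->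
    forall x, U x -> {for x, continuous ta}.
  move=> Ct x Ux; apply: continuous_rV => j; exact: (Ck_continuous oU (Ct j) Ux).
have c0 k' F' : (forall j, Ck k' U (fun x => ta x 0 j)) -> Ck k' V F' ->
    {within U, continuous F' \o ta}.
  move=> Ct CF; apply/within_open => // x Ux; apply: continuous_comp.
    exact: cta Ct _ Ux.
  exact: Ck_continuous oV CF (UV _ Ux).
elim: k F => [|k IH] F Ct CF; first by split=> //; exact: c0 Ct CF.
split; first exact: c0 Ct CF.
have C1F : Ck 1 V F by exact: Ck_le CF.
have dF x : U x -> differentiable F (ta x).
  by move=> Ux; apply: C1_differentiable oV C1F (UV _ Ux).
move=> i.
have D x : U x -> is_derive x (delta_mx 0 i) (F \o ta)
    (\sum_j 'D_(delta_mx 0 j) F (ta x) * 'D_(delta_mx 0 i) (fun y => ta y 0 j) x).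
  move=> Ux; apply: is_derive_comp_dir (dF _ Ux) => j.
  by have [_ /(_ i)[H _]] := Ct j; exact: H.
split=> [x /D[]//|].
apply: (@eq_Ck _ _ _ _ (fun x => \sum_j ('D_(delta_mx 0 j) F \o ta) x *
  'D_(delta_mx 0 i) (fun y => ta y 0 j) x)) => //.
  by move=> x /D [_ ->].
apply: Ck_sum => // j; apply: CkM => //; last by have [_ /(_ i)[]] := Ct j.
apply: IH; last by have [_ /(_ j)[]] := CF.
by move=> j'; exact: Ck_leS.
Qed.

(** * Hadamard's lemma *)

Section Hadamard.
Context {R : realType} {m : nat}.
Variables (a : 'rV[R]_m) (r : R).
Hypothesis r0 : 0 < r.
Local Notation B := (ball a r).
Local Notation mu := (@lebesgue_measure R).
Local Notation e_ i := (delta_mx 0 i : 'rV[R]_m).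
Implicit Types (H F : 'rV[R]_m -> R) (x : 'rV[R]_m).

Definition ray x (t : R) : 'rV[R]_m := t *: (x - a) + a.

Lemma ray_ball x t : B x -> t \in `[0, 1] -> B (ray x t).
Proof.
move=> [_ ax]; rewrite in_itv/= => /andP[t0 t1]; split=> // i j.
have := ax i j; rewrite /ball/= !mxE -normrN opprB => axj.
rewrite (_ : a i j - _ = - (t * (x i j - a i j))); last by ring.
rewrite normrN normrM ger0_norm//.
by apply: le_lt_trans axj; rewrite ler_piMl.
Qed.

(** The weight t ^+ j makes the family stable under differentiation: a partial
    derivative of [ray_integral j H] is [ray_integral j.+1] of the same partial
    derivative of H. *)
Definition ray_integral j H x : R := \int[mu]_(t in `[0, 1]) (t ^+ j * H (ray x t)).

Lemma ray_continuous : continuous (fun p : 'rV[R]_m * R => ray p.1 p.2).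
Proof.
move=> p; apply: continuous_rV => j; rewrite /prop_for /continuous_at.
have -> : (fun q : 'rV[R]_m * R => ray q.1 q.2 0 j) =
          (fun q => q.2 * (q.1 0 j - a 0 j) + a 0 j).
  by apply/funext => q; rewrite !mxE.
rewrite [ray _ _ _ _]mxE [X in X + _]mxE [X in _ * X + _]mxE [X in _ * (_ + X) + _]mxE.
apply: cvgD; last exact: cvg_cst.
apply: cvgM; first exact: cvg_snd.
apply: cvgB; last exact: cvg_cst.
apply: (cvg_comp (fun q : 'rV[R]_m * R => q.1) (fun y : 'rV[R]_m => y 0 j)).
  exact: cvg_fst.
exact: coord_continuous.
Qed.

Lemma ray_continuousr x : continuous (ray x).
Proof.
move=> t; apply: continuous_rV => j.
have -> : (fun s => ray x s 0 j) = (fun s => s * (x 0 j - a 0 j) + a 0 j).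
  by apply/funext => s; rewrite !mxE.
by apply: cvgD; [apply: cvgMr_tmp; exact: cvg_id|exact: cvg_cst].
Qed.

Lemma integrand_continuous j H x : Ck 0 B H -> B x ->
  {within `[0, 1], continuous (fun t : R => t ^+ j * H (ray x t))}.
Proof.
move=> CH Bx; apply: continuous_in_subspaceT => t /set_mem/= t01.
apply: cvgM; first exact: exprn_continuous.
apply: (continuous_comp (@ray_continuousr x t)).
apply: (Ck_continuous _ CH); first exact: ball_open.
exact: ray_ball.
Qed.

Lemma integrand_integrable j H x : Ck 0 B H -> B x ->
  mu.-integrable `[0, 1] (EFin \o (fun t : R => t ^+ j * H (ray x t))).
Proof.
move=> CH Bx; apply: continuous_compact_integrable; first exact: segment_compact.
exact: integrand_continuous.
Qed.

Lemma Rintegral01_cst (c : R) : \int[mu]_(t in `[0, 1]) c = c.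
Proof.
rewrite Rintegral_cst//= lebesgue_measure_itv/= lte_fin ltr01 oppr0 addr0.
by rewrite mulr1.
Qed.

Lemma normr_Rintegral01_le (f : R -> R) (c : R) :
  mu.-integrable `[0, 1] (EFin \o f) -> (forall t, t \in `[0, 1] -> `|f t| <= c) ->
  `|\int[mu]_(t in `[0, 1]) f t| <= c.
Proof.
move=> If fc; rewrite -[leRHS]Rintegral01_cst.
apply: le_trans (le_normr_Rintegral _ If) _ => //.
apply: le_Rintegral => //.
- exact: integrable_norm.
- apply: continuous_compact_integrable; first exact: segment_compact.
  by apply: continuous_subspaceT => ?; exact: cst_continuous.
Qed.

(** Compactness of the parameter interval makes the estimate uniform in t. *)
Lemma ray_unif_continuous H x (eps : R) : Ck 0 B H -> B x -> 0 < eps ->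
  \forall y \near x, B y /\
    forall t : R, t \in `[0, 1] -> `|H (ray x t) - H (ray y t)| <= eps.
Proof.
move=> CH Bx eps0; have oB : open B by exact: ball_open.
have cov : near_covering (`[0, 1]%classic : set R).
  by apply/compact_near_coveringP; exact: segment_compact.
have Hn : \forall y \near x, `[0, 1]%classic `<=`
    (fun t : R => `|H (ray x t) - H (ray y t)| <= eps).
  apply: (cov 'rV[R]_m (nbhs x) _ (@nbhs_filter _ x)) => t t01.
  have CHt : {for ray x t, continuous H}.
    by apply: (Ck_continuous oB CH); exact: ray_ball.
  have c1 : H (ray x s) @[s --> t] --> H (ray x t).
    exact: (continuous_comp (ray_continuousr (x := x) (x0 := t)) CHt).
  have c2 : H (ray p.2 p.1) @[p --> (t, x)] --> H (ray x t).
    have sw : (p.2, p.1) @[p --> (t, x)] --> (x, t).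
      exact: (@swap_continuous _ _ (t, x)).
    have rc : ray p.2 p.1 @[p --> (t, x)] --> ray x t.
      exact: (cvg_comp _ _ sw (@ray_continuous (x, t))).
    exact: (cvg_comp _ _ rc CHt).
  have c3 : H (ray x p.1) @[p --> (t, x)] --> H (ray x t).
    apply: (cvg_comp (fun p : R * 'rV[R]_m => p.1) (fun s => H (ray x s))).
      exact: cvg_fst.
    exact: c1.
  have c4 : H (ray x p.1) - H (ray p.2 p.1) @[p --> (t, x)] --> 0.
    by rewrite -[X in _ --> X](subrr (H (ray x t))); exact: cvgB.
  move/cvgrPdist_le : c4 => /(_ _ eps0).
  by apply: filterS => p; rewrite sub0r normrN.
have BB : \forall y \near x, B y by exact: open_nbhs_nbhs.
apply: filterS2 BB Hn => y By Hy; split=> // t t01; exact: Hy.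
Qed.

Lemma ray_integral_continuous j H x : Ck 0 B H -> B x ->
  {for x, continuous (ray_integral j H)}.
Proof.
move=> CH Bx.
apply/(@cvgrPdist_le _ _ _ _ (nbhs_filter x)) => eps eps0.
apply: filterS (ray_unif_continuous CH Bx eps0) => y [By Hy].
rewrite /ray_integral -RintegralB//; try exact: integrand_integrable.
apply: normr_Rintegral01_le.
  have := integrableB _ (integrand_integrable j CH Bx)
    (integrand_integrable j CH By).
  by apply.
move=> t t01; rewrite -mulrBr normrM.
apply: le_trans (Hy _ t01); rewrite ler_piMl// normrX.
move: t01; rewrite in_itv/= => /andP[t0 t1]; rewrite ger0_norm//.
exact: exprn_ile1.
Qed.

(** Differentiation under the integral sign, dominated near x by the integrable
    function t |-> |D_i H (ray x t)| + 1. *)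
Lemma is_derive_ray_integral j H x i : Ck 1 B H -> B x ->
  is_derive x (e_ i) (ray_integral j H)
    (ray_integral j.+1 (fun y => 'D_(e_ i) H y) x).
Proof.
move=> CH Bx; have oB : open B by exact: ball_open.
have CH0 : Ck 0 B H by case: CH.
have CD : Ck 0 B (fun y => 'D_(e_ i) H y) by have [_ /(_ i)[]] := CH.
have line_cvg : (s *: e_ i + x : 'rV[R]_m) @[s --> (0 : R)] --> x.
  have : {for (0 : R), continuous (fun s : R => s *: e_ i + x : 'rV[R]_m)}.
    apply: continuous_rV => k.
    have -> : (fun s : R => (s *: e_ i + x) 0 k) = (fun s => s * e_ i 0 k + x 0 k).
      by apply/funext => s; rewrite !mxE.
    by apply: cvgD; [apply: cvgMr_tmp; exact: cvg_id|exact: cvg_cst].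
  by rewrite /prop_for /continuous_at scale0r add0r.
have /nbhs_ballP[d /= d0 Hd] : \forall s \near (0 : R), B (s *: e_ i + x) /\
    forall t : R, t \in `[0, 1] ->
     `|'D_(e_ i) H (ray x t) - 'D_(e_ i) H (ray (s *: e_ i + x) t)| <= 1.
  exact: (line_cvg _ (ray_unif_continuous CD Bx ltr01)).
have Id s : (`]-d, d[%classic : set R) s -> ball (0 : R) d s.
  by rewrite /= in_itv/= /ball/= sub0r normrN ltr_norml.
pose f (s t : R) := t ^+ j * H (ray (s *: e_ i + x) t).
have df s t : (`]-d, d[%classic : set R) s -> t \in `[0, 1] ->
    is_derive s 1 (f^~ t) (t ^+ j.+1 * 'D_(e_ i) H (ray (s *: e_ i + x) t)).
  move=> /Id/Hd[Bs _] t01.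
  have rE u : ray (u *: e_ i + x) t = u *: (t *: e_ i) + ray x t.
    by rewrite /ray -[_ *: e_ i + x - a]addrA scalerDr addrA scalerA mulrC -scalerA.
  have dH : differentiable H (s *: (t *: e_ i) + ray x t).
    by rewrite -rE; apply: C1_differentiable oB CH _; exact: ray_ball.
  have dd : derivable H (s *: (t *: e_ i) + ray x t) (t *: e_ i).
    exact: diff_derivable.
  have [d1 E] := is_derive_line dd.
  rewrite /f; under eq_fun do rewrite rE.
  apply: is_derive_eq; first exact: is_deriveZ.
  rewrite E deriveE// linearZ/= -deriveE//.
  by rewrite exprSr -mulrA rE.
pose G (t : R) := `|'D_(e_ i) H (ray x t)| + 1.
have I0 : (`]-d, d[%classic : set R) 0 by rewrite /= in_itv/= oppr_lt0 d0.
have mI : measurable (`[0, 1]%classic : set (measurableTypeR R)) by [].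
have intf s : (`]-d, d[%classic : set R) s -> mu.-integrable `[0, 1] (EFin \o f s).
  by move=> /Id/Hd[Bs _]; exact: integrand_integrable.
have derf s t : (`]-d, d[%classic : set R) s -> (`[0, 1]%classic : set R) t ->
    derivable (f^~ t) s 1 by move=> Is It; have [] := df s t Is It.
have G0 t : 0 <= G t by rewrite addr_ge0.
have intG : mu.-integrable `[0, 1] (EFin \o G).
  apply: continuous_compact_integrable; first exact: segment_compact.
  apply: continuous_in_subspaceT => t /set_mem/= t01.
  apply: cvgD; last exact: cvg_cst.
  have cD : {for ray x t, continuous (fun y => 'D_(e_ i) H y)}.
    by apply: (Ck_continuous oB CD); exact: ray_ball.
  by apply: cvg_norm; exact: (cvg_comp _ _ (@ray_continuousr x t) cD).
have Gub s t : (`]-d, d[%classic : set R) s -> (`[0, 1]%classic : set R) t ->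
    `|partial1of2 f s t| <= G t.
  move=> Is It; rewrite partial1of2E; have [_ ->] := df s t Is It.
  have [_ /(_ t It) Ht] := Hd s (Id s Is).
  rewrite normrM normrX.
  apply: (@le_trans _ _ `|'D_(e_ i) H (ray (s *: e_ i + x) t)|).
    rewrite ler_piMl//; move: It; rewrite /= in_itv/= => /andP[t0 t1].
    by rewrite ger0_norm//; exact: exprn_ile1.
  rewrite -[X in `|X|](subrK ('D_(e_ i) H (ray x t))) addrC /G.
  by rewrite (le_trans (ler_normD _ _))// lerD2l distrC.
have dJ := derivable_under_integral mI I0 intf derf G0 intG Gub.
have DJ := differentiation_under_integral mI I0 intf derf G0 intG Gub.
have dR : derivable (ray_integral j H) x (e_ i) by apply/derivable1P; exact: dJ.
split=> //.
have := @is_derive_line _ _ (ray_integral j H) x (e_ i) 0.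
rewrite scale0r add0r => /(_ dR)[_ <-].
rewrite -derive1E [LHS]DJ /ray_integral.
apply: eq_Rintegral => t; rewrite inE => It.
rewrite partial1of2E; have [_ ->] := df 0 t I0 It.
by rewrite scale0r add0r.
Qed.

Lemma Ck_ray_integral k j H : Ck k B H -> Ck k B (ray_integral j H).
Proof.
have oB : open B by exact: ball_open.
elim: k j H => [|k IH] j H CH.
  by apply: Ck0P => // x; exact: ray_integral_continuous.
have C1 : Ck 1 B H by exact: Ck_le CH.
split; first by apply/within_open => // x; apply: ray_integral_continuous;
  exact: Ck_le CH.
move=> i; split=> [x Bx|]; first by have [] := is_derive_ray_integral j i C1 Bx.
have [_ /(_ i)[_ CD]] := CH.
apply: (eq_Ck oB _ (IH j.+1 _ CD)) => x Bx.
by have [_ ->] := is_derive_ray_integral j i C1 Bx.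
Qed.

(** Integrate the derivative of t |-> F (a + t (x - a)) over [0, 1]. *)
Lemma hadamard F x : Ck 1 B F -> B x ->
  F x = F a + \sum_i (x 0 i - a 0 i) * ray_integral 0 (fun y => 'D_(e_ i) F y) x.
Proof.
move=> C1 Bx; have oB : open B by exact: ball_open.
have CD i : Ck 0 B (fun y => 'D_(e_ i) F y) by have [_ /(_ i)[]] := C1.
pose f (t : R) := \sum_i 'D_(e_ i) F (ray x t) * (x 0 i - a 0 i).
have dF (t : R) : t \in `[0, 1] -> is_derive t 1 (F \o ray x) (f t).
  move=> t01.
  have dr i : is_derive t 1 (fun s => ray x s 0 i) (x 0 i - a 0 i).
    have -> : (fun s => ray x s 0 i) =
              (id : R -> R) * cst (x 0 i - a 0 i) + cst (a 0 i).
      by apply/funext => s; rewrite !mxE.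
    by apply: is_derive_eq; rewrite addr0 scaler0 add0r [_%:A]mulr1.
  have H1 i : derivable (fun s => ray x s 0 i) t 1 by have [] := dr i.
  have H2 : differentiable F (ray x t).
    by apply: C1_differentiable oB C1 _; exact: ray_ball.
  have [d1 E] := is_derive_curve H1 H2.
  split=> //; rewrite E; apply: eq_bigr => i _; have [_ ->] := dr i.
  by [].
pose S (s : seq 'I_m) (t : R) :=
  \sum_(i <- s) 'D_(e_ i) F (ray x t) * (x 0 i - a 0 i).
have cT i (t : R) : t \in `[0, 1] ->
    'D_(e_ i) F (ray x u) * (x 0 i - a 0 i) @[u --> t] -->
    'D_(e_ i) F (ray x t) * (x 0 i - a 0 i).
  move=> t01; apply: cvgMr_tmp.
  have cD : {for ray x t, continuous (fun y => 'D_(e_ i) F y)}.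
    by apply: (Ck_continuous oB (CD i)); exact: ray_ball.
  exact: (cvg_comp _ _ (@ray_continuousr x t) cD).
have iT i : mu.-integrable `[0, 1]
    (EFin \o (fun u => 'D_(e_ i) F (ray x u) * (x 0 i - a 0 i))).
  apply: continuous_compact_integrable; first exact: segment_compact.
  by apply: continuous_in_subspaceT => t /set_mem/=; exact: cT.
have cS s : {within `[0, 1], continuous (S s)}.
  apply: continuous_in_subspaceT => t /set_mem/= t01.
  by apply: (cvg_big (@add_continuous _)) => i _; exact: cT.
have iS s : mu.-integrable `[0, 1] (EFin \o S s).
  by apply: continuous_compact_integrable; first exact: segment_compact.
have f01 : \int[mu]_(t in `[0, 1]) f t = F x - F a.
  have c01 (t : R) : t \in `[0, 1] -> (F \o ray x) u @[u --> t] --> (F \o ray x) t.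
    by move=> /dF[/derivable1_diffP/differentiable_continuous].
  rewrite /Rintegral (continuous_FTC2 (F := F \o ray x)) //=.
  - by rewrite /ray scale1r subrK scale0r add0r.
  - exact: cS.
  - split; [|apply: cvg_at_right_filter|apply: cvg_at_left_filter].
    + by move=> t /subset_itv_oo_cc /dF [].
    + by apply: c01; rewrite in_itv/= lexx ler01.
    + by apply: c01; rewrite in_itv/= lexx ler01.
  - by move=> t /subset_itv_oo_cc /dF [_]; rewrite derive1E.
rewrite -[LHS](subrK (F a)) addrC -f01; congr (_ + _).
rewrite -[LHS]/(\int[mu]_(t in `[0, 1]) S (index_enum 'I_m) t).
elim: (index_enum 'I_m) => [|i s IHs].
  rewrite big_nil /S; under eq_Rintegral do rewrite big_nil.
  exact: Rintegral01_cst.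
rewrite big_cons -IHs /S; under eq_Rintegral do rewrite big_cons.
rewrite RintegralD//; last exact: iS.
congr (_ + _); rewrite RintegralZr//; last first.
  apply: continuous_compact_integrable; first exact: segment_compact.
  apply: continuous_in_subspaceT => t /set_mem/= t01.
  have cD : {for ray x t, continuous (fun y => 'D_(e_ i) F y)}.
    by apply: (Ck_continuous oB (CD i)); exact: ray_ball.
  exact: (cvg_comp _ _ (@ray_continuousr x t) cD).
rewrite mulrC /ray_integral; congr (_ * _).
by apply: eq_Rintegral => t _; rewrite expr0 mul1r.
Qed.

Lemma ray_integral_center H : ray_integral 0 H a = H a.
Proof.
rewrite /ray_integral -[RHS]Rintegral01_cst; apply: eq_Rintegral => t _.
by rewrite expr0 mul1r /ray subrr scaler0 add0r.
Qed.

End Hadamard.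

(** * Flat functions *)

Section Flat.
Context {R : realType}.

(** The functions t^-n exp(-1/t), extended by 0: the derivative of each is a
    combination of two others, so all of them are smooth, although they vanish
    on the negative half line. *)
Definition flat n (t : R) : R := if 0 < t then t^-1 ^+ n * expR (- t^-1) else 0.

Lemma flat_ge0 n t : 0 <= flat n t.
Proof.
rewrite /flat; case: ifP => // t0.
by rewrite mulr_ge0 ?expR_ge0// exprn_ge0// invr_ge0 ltW.
Qed.

Lemma flat_le n t : flat n t <= n.+2`!%:R * t ^+ 2.
Proof.
rewrite /flat; case: ifP => t0; last first.
  by rewrite mulr_ge0 ?sqr_ge0// ler0n.
have u0 : 0 < t^-1 by rewrite invr_gt0.
have F0 : 0 < (n.+2`!)%:R :> R by rewrite ltr0n fact_gt0.
have H : t^-1 ^+ n.+2 / n.+2`!%:R <= expR t^-1.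
  by apply: le_trans (expR_ge1Dxn n.+1 (ltW u0)); rewrite lerDr.
rewrite expRN ler_pdivrMr ?expR_gt0//.
have -> : t^-1 ^+ n = n.+2`!%:R * t ^+ 2 * (t^-1 ^+ n.+2 / n.+2`!%:R).
  rewrite -addn2 exprD; field.
  by rewrite !lt0r_neq0.
by rewrite ler_wpM2l// mulr_ge0 ?sqr_ge0// ler0n.
Qed.

Lemma flat_le0 n t : t <= 0 -> flat n t = 0.
Proof. by rewrite /flat leNgt => /negbTE ->. Qed.

Lemma flatS n t : flat n t = flat n.+1 t * t.
Proof.
rewrite /flat; case: ifP => t0; last by rewrite mul0r.
by rewrite exprS mulrAC [_^-1 * _]mulrC mulrVK// unitfE lt0r_neq0.
Qed.

Lemma flat_cvg0 n : flat n t @[t --> (0 : R)] --> (0 : R).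
Proof.
apply: (@squeeze_cvgr _ _ _ _ (cst 0) (fun t => n.+2`!%:R * t ^+ 2)).
- by near=> t; rewrite flat_ge0 flat_le.
- exact: cvg_cst.
- rewrite -[X in _ --> X](mulr0 (n.+2`!%:R : R)) -[X in _ * X](expr0n _ 2).
  by apply: cvgMl_tmp; exact: exprn_continuous.
Unshelve. all: by end_near.
Qed.

(** At 0 the difference quotient of [flat n] is [flat n.+1], which tends to 0
    there. *)
Lemma is_derive_flat n (t : R) :
  is_derive t 1 (flat n) (flat n.+2 t - n%:R * flat n.+1 t).
Proof.
have [t0|t0|->] := ltgtP t 0.
- rewrite !(flat_le0 _ (ltW t0)) mulr0 subr0.
  apply: (@near_eq_is_derive _ _ _ (cst 0)).
    by apply: filterS (lt_nbhsl t0) => s s0; rewrite flat_le0// ltW.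
- pose g : R -> R := (fun s => s^-1) ^+ n * (expR \o (- (fun s => s^-1))).
  apply: (@near_eq_is_derive _ _ _ g).
    by apply: filterS (lt_nbhsr t0) => s s0; rewrite /flat s0 /g !fctE.
  have dI : is_derive t (1 : R) (fun s : R => s^-1) (- t ^- 2).
    apply: is_derive_eq; first by apply: is_deriveV; rewrite gt_eqF.
    by rewrite [_%:A]mulr1.
  rewrite /g; apply: is_derive_eq.
  rewrite /flat t0 /=.
  rewrite !fctE /GRing.scale/= -[t ^- 2]exprVn.
  by case: (n) => [|n']; rewrite ?mulr0n/= ?exprS; ring.
- rewrite !flat_le0// mulr0 subr0; apply/is_derive1_caratheodory.
  exists (flat n.+1); split=> [z||].
  + by rewrite (@flat_le0 n 0)// !subr0 -flatS.
  + by rewrite /prop_for /continuous_at flat_le0//; exact: flat_cvg0.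
  + by rewrite flat_le0.
Qed.

Lemma is_derive_flat_comp {m} n (u : 'rV[R]_m -> R) x v : derivable u x v ->
  is_derive x v (flat n \o u)
    ((flat n.+2 (u x) - n%:R * flat n.+1 (u x)) * 'D_v u x).
Proof.
move=> du.
have L (G : 'rV[R]_m -> R) : derivable G x v ->
    is_derive (0 : R) 1 (fun s : R => G (s *: v + x)) ('D_v G x).
  move=> dG; have := @is_derive_line R m G x v (0 : R).
  by rewrite scale0r add0r; apply.
have := @is_derive1_comp R (flat n) (fun s : R => u (s *: v + x)) 0 _ _
  (is_derive_flat n _) (L u du).
rewrite scale0r add0r => -[d1 E].
have d2 : derivable (flat n \o u) x v by apply/derivable1P; exact: d1.
by split=> //; rewrite -E; have [_ <-] := L _ d2.
Qed.

Lemma Ck_flat_comp {m} k n (U : set 'rV[R]_m) (u : 'rV[R]_m -> R) : open U ->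
  (forall l, Ck l U u) -> Ck k U (flat n \o u).
Proof.
move=> oU Cu.
have cu n' : {within U, continuous (flat n' \o u)}.
  apply/within_open => // x Ux; apply: continuous_comp.
    exact: Ck_continuous oU (Cu 0) Ux.
  apply: differentiable_continuous; apply/derivable1_diffP.
  by have [] := is_derive_flat n' (u x).
elim: k n => [//|k IH] n.
split=> // i; have [_ /(_ i)[du Du]] := Cu 1.
split=> [x Ux|]; first by have [] := is_derive_flat_comp n (du x Ux).
apply: (@eq_Ck _ _ _ _ (fun x => ((flat n.+2 \o u) x + (- n%:R) * (flat n.+1 \o u) x) *
    'D_(delta_mx 0 i) u x)) => //.
  by move=> x Ux; have [_ ->] := is_derive_flat_comp n (du x Ux); rewrite mulNr.
apply: CkM => //; last by have [_ /(_ i)[]] := Cu k.+1.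
apply: CkD => //; apply: CkM => //; exact: Ck_cst.
Qed.

End Flat.

(** * Bump functions and extension by zero from a chart *)

Lemma open_within_preimage (T S : topologicalType) (A : set T) (f : T -> S)
    (X : set S) : open A -> {within A, continuous f} -> open X ->
  open (A `&` f @^-1` X).
Proof.
by move=> oA; rewrite continuous_open_subspace// => /(continuous_inP _ oA); apply.
Qed.

Section Coordinates.
Context {R : realType} {m : nat}.

Lemma is_derive_coord (x v : 'rV[R]_m) j :
  is_derive x v (fun y : 'rV[R]_m => y 0 j) (v 0 j).
Proof.
have E : (fun h : R => h^-1 *: (((fun y : 'rV[R]_m => y 0 j) \o shift x) (h *: v)
   - x 0 j)) @ 0^' --> v 0 j.
  apply: cvg_near_cst; near=> h.
  have h0 : h != 0 by near: h; exact: nbhs_dnbhs_neq.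
  by rewrite /= !mxE addrK /GRing.scale/= mulKf.
by split; [apply/cvg_ex; exists (v 0 j)|exact: cvg_lim E].
Unshelve. all: by end_near.
Qed.

Lemma Ck_coord k (U : set 'rV[R]_m) j : open U -> Ck k U (fun y => y 0 j).
Proof.
move=> oU; have cc : {within U, continuous (fun y : 'rV[R]_m => y 0 j)}.
  by apply: continuous_subspaceT => x; exact: coord_continuous.
case: k => [//|k]; split=> // i; split=> [x _|].
  by have [] := is_derive_coord x (delta_mx 0 i) j.
apply: (eq_Ck oU _ (Ck_cst k ((delta_mx 0 i : 'rV[R]_m) 0 j) oU)) => x _.
by have [_ ->] := is_derive_coord x (delta_mx 0 i) j.
Qed.

Variables (a : 'rV[R]_m) (s : R).

Definition bump_fun (x : 'rV[R]_m) : R := flat 0 (s ^+ 2 - \sum_i (x 0 i - a 0 i) ^+ 2).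

Lemma Ck_bump k U : open U -> Ck k U bump_fun.
Proof.
move=> oU; apply: (Ck_flat_comp k 0 oU) => l.
have Cs : Ck l U (fun x : 'rV[R]_m => \sum_i (x 0 i - a 0 i) ^+ 2).
  apply: Ck_sum => // i.
  have Ci : Ck l U (fun x : 'rV[R]_m => x 0 i - a 0 i).
    by apply: CkD => //; [exact: Ck_coord|exact: Ck_cst].
  by apply: (eq_Ck oU _ (CkM oU Ci Ci)) => x _; rewrite expr2.
apply: (eq_Ck oU _ (CkD oU (Ck_cst l (s ^+ 2) oU) (CkM oU (Ck_cst l (-1) oU) Cs))).
by move=> x _; rewrite /cst mulN1r.
Qed.

Definition cube := [set x : 'rV[R]_m | forall i, x 0 i \in `[a 0 i - s, a 0 i + s]].

Lemma compact_cube : compact cube.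
Proof.
apply: (rV_compact (A := fun i => `[a 0 i - s, a 0 i + s]%classic)) => i.
exact: segment_compact.
Qed.

Hypothesis s0 : 0 < s.

Lemma bump_center : 0 < bump_fun a.
Proof.
rewrite /bump_fun big1 ?subr0 => [|i _]; last by rewrite subrr expr0n.
by rewrite /flat exprn_gt0// expr0 mul1r expR_gt0.
Qed.

Lemma bump_out x : ~ cube x -> bump_fun x = 0.
Proof.
move=> /existsNP[i /negP]; rewrite in_itv/= => xi.
apply: flat_le0; rewrite subr_le0 (bigD1 i)//=.
apply: ler_wpDr; first by apply: sumr_ge0 => ? _; exact: sqr_ge0.
rewrite -[leRHS]real_normK ?num_real// ler_sqr ?nnegrE ?(ltW s0)//.
by apply: contraR xi; rewrite -ltNge => /ltW; rewrite ler_distl.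
Qed.

Lemma cube_ball r : s < r -> cube `<=` ball a r.
Proof.
move=> sr x xc; split=> [|k i]; first exact: lt_trans sr.
have := xc i; rewrite ord1 in_itv/= -ler_distl /ball/= distrC => /le_lt_trans.
exact.
Qed.

End Coordinates.

Section Extension.
Context {R : realType} {m : nat} (M : smoothManifold R m).
Variables (c : chart R m M) (U : set 'rV[R]_m).
Hypotheses (ac : atlas c) (oU : open U) (Uc : U `<=` chart_codom c).

Definition zero_ext (F : 'rV[R]_m -> R) (q : M) : R :=
  if `[< chart_dom c q /\ U (chart_fun c q) >] then F (chart_fun c q) else 0.

(** In another chart, F composed with the transition map is smooth on the
    preimage of U by the chain rule.  The remaining points are outside the
    image of K in M, which is closed because K is compact and M is Hausdorff,
    and near such a point the extension is zero. *)
Lemma smooth_zero_ext (K : set 'rV[R]_m) F : compact K -> K `<=` U ->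
  (forall x, U x -> ~ K x -> F x = 0) -> smooth_on U F ->
  smooth (zero_ext F).
Proof.
move=> cK KU FK sF d ad k; have od := @chart_codom_open _ _ _ d.
apply: Ck_local => // y dy; set q := chart_inv d y.
pose O := chart_codom d `&` chart_inv d @^-1` chart_dom c.
have oO : open O.
  apply: open_within_preimage; [exact: od|exact: chart_inv_continuous|].
  exact: chart_dom_open.
pose ta x := chart_fun c (chart_inv d x).
have Cta l j : Ck l O (fun x => ta x 0 j) by exact: (atlas_compatible ad ac).
have [[cq Uq]|nq] := pselect (chart_dom c q /\ U (chart_fun c q)).
  have oV : open (O `&` ta @^-1` U).
    apply: open_within_preimage => //; apply/within_open => // x Ox.
    by apply: continuous_rV => j; exact: (Ck_continuous oO (Cta 0%N j) Ox).
  exists (O `&` ta @^-1` U); split=> //.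
  have CF : Ck k (O `&` ta @^-1` U) (F \o ta).
    apply: (Ck_comp (V := U)) => //; first by move=> x [].
    by move=> j; apply: (Ck_sub oO oV _ (Cta k j)) => x [].
  apply: (eq_Ck oV _ CF) => x [[dx cx] Ux] /=.
  by rewrite /zero_ext asboolT.
pose C := chart_inv c @` K.
have clC : closed C.
  apply: compact_closed; first exact: manifold_hausdorff.
  apply: continuous_compact => //.
  apply: continuous_subspaceW (@chart_inv_continuous _ _ _ c).
  exact: subset_trans Uc.
have oV : open (chart_codom d `&` chart_inv d @^-1` ~` C).
  apply: open_within_preimage; [exact: od|exact: chart_inv_continuous|].
  exact: closed_openC.
exists (chart_codom d `&` chart_inv d @^-1` ~` C); split=> //.
  split=> // -[x Kx xq]; apply: nq; rewrite /q -xq; split.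
    by apply: chart_invP; exact/Uc/KU.
  by rewrite chart_invK; [exact: KU|exact/Uc/KU].
apply: (eq_Ck oV _ (Ck_cst k 0 oV)) => x [dx nCx] /=.
rewrite /zero_ext; case: asboolP => // -[cx Ux].
rewrite FK// => Kx; apply: nCx; exists (chart_fun c (chart_inv d x)) => //.
exact: chart_funK.
Qed.

End Extension.

(** * Tangent vectors as values of vector fields *)

Section TangentExtension.
Context {R : realType} {m : nat} (M : smoothManifold R m).
Local Notation C := (smoothFun M).
Local Notation VF := (vectorField M).

Section AtPoint.
Variables (p : M) (c : chart R m M) (r : R).
Hypotheses (ac : atlas c) (cp : chart_dom c p) (r0 : 0 < r).
Local Notation a := (chart_fun c p).
Local Notation U := (ball a r).
Hypothesis Uc : U `<=` chart_codom c.
Local Notation e_ i := (delta_mx 0 i : 'rV[R]_m).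
Local Notation h := (bump_fun a (r / 2)).

Let oU : open U. Proof. exact: ball_open. Qed.
Let s0 : 0 < r / 2. Proof. by rewrite divr_gt0. Qed.
Let Ua : U a. Proof. exact: ballxx. Qed.

(** Multiplication by the bump function turns a function smooth on the
    coordinate ball U only into a globally smooth function on M. *)
Fact smooth_cutoff (F : 'rV[R]_m -> R) : smooth_on U F ->
  smooth (zero_ext c U (fun x => h x * F x)).
Proof.
move=> sF; apply: (smooth_zero_ext ac oU Uc (@compact_cube R m a (r / 2))).
- by apply: cube_ball => //; rewrite ltr_pdivrMr// ltr_pMr// ltr1n.
- by move=> x _ nx; rewrite bump_out// mul0r.
- by move=> k; apply: CkM => //; exact: Ck_bump.
Qed.

Definition cutoff F (sF : smooth_on U F) : C := mk_smooth (smooth_cutoff sF).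

Lemma cutoffE F (sF : smooth_on U F) q : chart_dom c q -> U (chart_fun c q) ->
  cutoff sF q = h (chart_fun c q) * F (chart_fun c q).
Proof. by move=> cq Uq; rewrite /cutoff/= /zero_ext asboolT. Qed.

Lemma cutoff_out F (sF : smooth_on U F) q :
  ~ (chart_dom c q /\ U (chart_fun c q)) -> cutoff sF q = 0.
Proof. by move=> nq; rewrite /cutoff/= /zero_ext asboolF. Qed.

Definition local_rep (f : C) (x : 'rV[R]_m) : R := f (chart_inv c x).

Lemma smooth_local_rep f : smooth_on U (local_rep f).
Proof.
by move=> k; exact: Ck_sub (@chart_codom_open _ _ _ c) oU Uc (smoothP f ac k).
Qed.

Lemma smooth_partial F i : smooth_on U F -> smooth_on U (fun x => 'D_(e_ i) F x).
Proof. by move=> sF k; have [_ /(_ i)[]] := sF k.+1. Qed.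

Lemma derivable_local_rep f i x : U x -> derivable (local_rep f) x (e_ i).
Proof. by move=> Ux; have [_ /(_ i)[H _]] := smooth_local_rep f 1; exact: H. Qed.

(** The i-th coordinate derivative of the chart, damped by the bump function so
    that it is a derivation of the ring of global smooth functions. *)
Definition coord_deriv i (f : C) : C :=
  cutoff (smooth_partial i (smooth_local_rep f)).

Fact coord_deriv_derivation i :
  (coord_deriv i : C -> (C : pzRingType)^o) \in @derivation R m M.
Proof.
apply/asboolP; split=> [f g|b f|f g]; apply: smoothFunP => q.
- rewrite -[RHS]/(coord_deriv i f q + coord_deriv i g q).
  have [[cq Uq]|nq] := pselect (chart_dom c q /\ U (chart_fun c q)); last first.
    by rewrite /coord_deriv !cutoff_out ?addr0.
  rewrite /coord_deriv !cutoffE// -mulrDr; congr (_ * _).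
  have -> : local_rep (f + g) = local_rep f + local_rep g by [].
  by apply: deriveD; exact: derivable_local_rep.
- rewrite -[RHS]/(b * coord_deriv i f q).
  have [[cq Uq]|nq] := pselect (chart_dom c q /\ U (chart_fun c q)); last first.
    by rewrite /coord_deriv !cutoff_out ?mulr0.
  rewrite /coord_deriv !cutoffE// mulrCA; congr (_ * _).
  have -> : local_rep (cstC M b * f) = b *: local_rep f by [].
  by rewrite deriveZ//; exact: derivable_local_rep.
- rewrite -[RHS]/(f q * coord_deriv i g q + g q * coord_deriv i f q).
  have [[cq Uq]|nq] := pselect (chart_dom c q /\ U (chart_fun c q)); last first.
    by rewrite /coord_deriv !cutoff_out ?mulr0 ?addr0.
  rewrite /coord_deriv !cutoffE// [f q * _]mulrCA [g q * _]mulrCA -mulrDr;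
    congr (_ * _).
  have -> : local_rep (f * g) = local_rep f * local_rep g by [].
  rewrite deriveM; [|exact: derivable_local_rep..].
  by rewrite /local_rep chart_funK.
Qed.

Definition coord_field i : VF := VectorField (coord_deriv_derivation i).

Lemma smooth_on_cst (b : R) : smooth_on U (cst b).
Proof. by move=> k; exact: Ck_cst. Qed.

Lemma smooth_on_coord i : smooth_on U (fun x => x 0 i - a 0 i).
Proof. by move=> k; apply: CkD => //; [exact: Ck_coord|exact: Ck_cst]. Qed.

Lemma smooth_on_ray_integral H : smooth_on U H -> smooth_on U (ray_integral a 0 H).
Proof. by move=> sH k; exact: Ck_ray_integral. Qed.

Definition hadamard_factor i (f : C) : C := cutoff (smooth_on_ray_integral
  (smooth_partial i (smooth_local_rep f))).

Definition cut_coord i : C := cutoff (smooth_on_coord i).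
Definition cut_one : C := cutoff (smooth_on_cst 1).

(** Hadamard's lemma for f in the chart, multiplied by the square of the bump
    function: one factor for each of the two local factors of a summand. *)
Lemma cutoff_hadamard f :
  cut_one * cut_one * f = cstC M (f p) * (cut_one * cut_one)
     + \sum_i cut_coord i * hadamard_factor i f.
Proof.
apply: smoothFunP => q.
have sumE (I : Type) (s : seq I) (k : I -> C) :
    (\sum_(i <- s) k i) q = \sum_(i <- s) k i q.
  by elim/big_rec2: _ => // i y x _ <-.
rewrite -[LHS]/(cut_one q * cut_one q * f q).
rewrite -[RHS]/(f p * (cut_one q * cut_one q)
  + (\sum_i cut_coord i * hadamard_factor i f) q) sumE.
have [[cq Uq]|nq] := pselect (chart_dom c q /\ U (chart_fun c q)); last first.
  rewrite /cut_one !cutoff_out// !mul0r mulr0 add0r big1// => i _.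
  rewrite -[LHS]/(cut_coord i q * hadamard_factor i f q) /cut_coord cutoff_out//.
  by rewrite mul0r.
under eq_bigr => i _ do
  rewrite -[smooth_val _ _]/(cut_coord i q * hadamard_factor i f q)
    /cut_coord /hadamard_factor !cutoffE// mulrACA.
rewrite -mulr_sumr /cut_one !cutoffE// /cst !mulr1 mulrC [f p * _]mulrC -mulrDr.
have C1 := smooth_local_rep f 1.
have := hadamard r0 C1 Uq; rewrite /local_rep !chart_funK// => ->.
by rewrite mulrC.
Qed.

(** A derivation v is applied to [cutoff_hadamard]: the terms in v (h^2) cancel,
    and the coordinate functions vanish at p. *)
Lemma tangent_coord (v : tangent p) (f : C) :
  h a ^+ 2 * v f = \sum_i v (cut_coord i) * coord_field i f p.
Proof.
have [vD vZ vM] := tangentP v.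
have v0 : v 0 = 0 by apply: (addrI (v 0)); rewrite -vD !addr0.
have vs (I : Type) (s : seq I) (k : I -> C) :
    v (\sum_(i <- s) k i) = \sum_(i <- s) v (k i).
  by elim/big_rec2: _ => // i y x _ <-.
have cp1 : cut_one p = h a by rewrite /cut_one cutoffE// /cst mulr1.
have := congr1 v (cutoff_hadamard f).
rewrite vD vZ vs (vM (cut_one * cut_one)).
rewrite -[smooth_val (cut_one * cut_one) p]/(cut_one p * cut_one p) cp1.
rewrite addrC => /addrI; rewrite -expr2 => ->.
apply: eq_bigr => i _; rewrite vM /cut_coord /hadamard_factor !cutoffE// subrr.
rewrite !mulr0 mul0r add0r mulrC; congr (_ * _).
by rewrite ray_integral_center.
Qed.

End AtPoint.

Lemma tangent_extension (p : M) (v : tangent p) :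
  exists X : VF, field_at X p = v.
Proof.
have [c ac cp] := atlas_cover p.
have : nbhs (chart_fun c p) (chart_codom c).
  by apply: open_nbhs_nbhs; split; [exact: chart_codom_open|exact: chart_funP].
move=> /nbhs_ballP[r /= r0 Uc].
set h := bump_fun (chart_fun c p) (r / 2) (chart_fun c p).
have h0 : 0 < h by apply: bump_center; rewrite divr_gt0.
exists (\sum_i cstC M (v (cut_coord ac r0 Uc i) / h ^+ 2) *: coord_field ac r0 Uc i).
apply: val_inj; apply/funext => f.
have sE (I : Type) (s : seq I) (k : I -> VF) :
    field_at (\sum_(i <- s) k i) p f = \sum_(i <- s) field_at (k i) p f.
  by elim/big_rec2: _ => // i y x _ <-.
rewrite -[LHS]/(field_at _ p f) sE.
apply: (@mulfI _ (h ^+ 2)); first by rewrite expf_neq0// gt_eqF.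
rewrite (tangent_coord ac cp r0 Uc v f) mulr_sumr; apply: eq_bigr => i _.
rewrite -[field_at _ _ _]/
  (v (cut_coord ac r0 Uc i) / h ^+ 2 * coord_field ac r0 Uc i f p).
by rewrite mulrA mulrCA mulfV ?mulr1// expf_neq0// gt_eqF.
Qed.

(** Pointwise nondegeneracy applies, every tangent vector being the value of a
    vector field. *)
Lemma metric_app_inj (g : metric M) (X : VF) : (forall Y, g X Y = 0) -> X = 0.
Proof.
move=> gX; apply: val_inj; apply/funext => f; apply: smoothFunP => p.
have X0 : field_at X p = 0.
  apply: (@metric_nondegenerate _ _ _ g p) => v; have [Y <-] := tangent_extension v.
  exact: (congr1 (fun k : C => k p) (gX Y)).
by rewrite -[LHS]/(field_at X p f) X0.
Qed.

End TangentExtension.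

(** * Curvature-like quadrilinear forms *)

Section CurvatureLike.
Variables (C : comPzRingType) (V : zmodType) (B : V -> V -> V -> V -> C).
Hypothesis reg2 : forall x : C, 2 * x = 0 -> x = 0.
Hypothesis BD : forall X Y Z W T, B (X + Y) Z W T = B X Z W T + B Y Z W T.
Hypothesis skew12 : forall X Y Z W, B Y X Z W = - B X Y Z W.
Hypothesis skew34 : forall X Y Z W, B X Y W Z = - B X Y Z W.
Hypothesis bianchi : forall X Y Z W,
  B X Y Z W + B Y Z X W + B Z X Y W = 0.

(** Take the four Bianchi identities whose first three arguments are consecutive
    in the cyclic order X, Y, Z, W: the sum of the first two minus the sum of
    the last two is twice the claim. *)
Lemma pair_symmetry X Y Z W : B X Y Z W = B Z W X Y.
Proof using reg2 skew12 skew34 bianchi.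
apply/eqP; rewrite -subr_eq0; apply/eqP/reg2.
have := bianchi X Y Z W; have := bianchi Y Z W X.
have := bianchi Z W X Y; have := bianchi W X Y Z.
rewrite (skew34 Y Z X W) (skew34 Z W X Y) (skew34 W X Y Z) (skew34 X Z Y W).
rewrite (skew12 Z X Y W) (skew34 X Y Z W) (skew12 W Y X Z) (skew34 W Y Z X) opprK.
move=> b4 b3 b2 b1.
rewrite -[RHS](subr0 0) -[X in _ = X - _](addr0 0) -{1}b1 -{1}b2 -[X in _ - X](addr0 0).
rewrite -{1}b3 -{1}b4; ring.
Qed.

Hypothesis reg3 : forall x : C, 3 * x = 0 -> x = 0.

Let BD2 X Y Y' Z W : B X (Y + Y') Z W = B X Y Z W + B X Y' Z W.
Proof. by rewrite skew12 BD opprD -!skew12. Qed.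

Let BD3 X Y Z Z' W : B X Y (Z + Z') W = B X Y Z W + B X Y Z' W.
Proof. by rewrite pair_symmetry BD ![B _ W X Y]pair_symmetry. Qed.

Let BD4 X Y Z W W' : B X Y Z (W + W') = B X Y Z W + B X Y Z W'.
Proof. by rewrite skew34 BD3 opprD -!skew34. Qed.

(** Polarization shows that B is skew in its second and fourth arguments; with
    the other symmetries, the three terms of the Bianchi identity are then
    equal. *)
Lemma sectional_eq0 : (forall X Y, B X Y X Y = 0) -> forall X Y Z W, B X Y Z W = 0.
Proof.
move=> s0; have ps := pair_symmetry.
have q X Y Z : B X Y Z Y = 0.
  apply: reg2; have := s0 (X + Z) Y.
  by rewrite BD !BD3 !s0 (ps Z Y X Y) add0r addr0 mulr_natl mulr2n.
have r X Y Z W : B X Y Z W = - B X W Z Y.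
  apply/eqP; rewrite -addr_eq0; apply/eqP.
  by have := q X (Y + W) Z; rewrite BD2 !BD4 !q add0r addr0.
move=> X Y Z W; apply: reg3; rewrite -[RHS](bianchi X Y Z W).
rewrite (ps Y Z X W) (r X W Y Z) (skew12 Z X Y W) opprK.
rewrite (ps Z X Y W) (r Y W Z X) (skew12 X Y Z W) opprK; ring.
Qed.

Variable J : V -> V.
Hypothesis JD : forall X Y, J (X + Y) = J X + J Y.
Hypothesis JJ : forall X Y Z W, B (J (J X)) Y Z W = - B X Y Z W.
Hypothesis J34 : forall X Y Z W, B X Y (J Z) (J W) = B X Y Z W.

Let JJ4 X Y Z W : B X Y Z (J (J W)) = - B X Y Z W.
Proof. by rewrite skew34 pair_symmetry JJ pair_symmetry skew34 opprK. Qed.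

Let J4 X Y Z W : B X Y Z (J W) = - B X Y (J Z) W.
Proof. by rewrite -J34 JJ4. Qed.

Let J2 X Y Z W : B X (J Y) Z W = - B (J X) Y Z W.
Proof. by rewrite pair_symmetry J4 pair_symmetry. Qed.

(** Let u = B(X,Y,X,Y) and v = B(X,JY,X,JY).  The part of the hypothesis for
    X + Y and X - Y that is of degree two in both X and Y, reduced by the
    invariance under J and the Bianchi identity, says u + 3 v = 0.  Replacing Y
    by J Y exchanges u and v, so 8 u = 0. *)
Lemma holomorphic_sectional_eq0 :
  (forall X, B X (J X) X (J X) = 0) -> forall X Y Z W, B X Y Z W = 0.
Proof.
move=> h0; apply: sectional_eq0.
have JN X : J (- X) = - J X.
  have J0 : J 0 = 0 by apply: (addrI (J 0)); rewrite -JD !addr0.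
  by apply: (addrI (J X)); rewrite -JD !subrr.
have BN X Y Z W : B (- X) Y Z W = - B X Y Z W.
  have B0 : B 0 Y Z W = 0 by apply: (addrI (B 0 Y Z W)); rewrite -BD !addr0.
  by apply: (addrI (B X Y Z W)); rewrite -BD !subrr.
have BN2 X Y Z W : B X (- Y) Z W = - B X Y Z W by rewrite skew12 BN -skew12.
have BN3 X Y Z W : B X Y (- Z) W = - B X Y Z W.
  by rewrite pair_symmetry BN pair_symmetry.
have BN4 X Y Z W : B X Y Z (- W) = - B X Y Z W by rewrite skew34 BN3 -skew34.
have key X Y : B X Y X Y + 3 * B X (J Y) X (J Y) = 0.
  have e1 : B Y (J Y) X (J X) = B X (J X) Y (J Y) by rewrite pair_symmetry.
  have e2 : B Y (J X) Y (J X) = B X (J Y) X (J Y).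
    by rewrite J2 J4 opprK skew12 skew34 opprK.
  have e3 : B X (J Y) Y (J X) = B X (J Y) X (J Y).
    by rewrite J4 skew34 opprK.
  have e4 : B Y (J X) X (J Y) = B X (J Y) X (J Y).
    by rewrite pair_symmetry.
  have e5 : B X (J X) Y (J Y) = B X (J Y) X (J Y) + B X Y X Y.
    apply/eqP; rewrite -subr_eq0 -[X in _ == X](bianchi X (J X) Y (J Y)).
    by rewrite (J2 X Y) J34 (skew12 X Y); apply/eqP; ring.
  apply: reg2; apply: reg2.
  have := h0 (X + Y); have := h0 (X - Y).
  rewrite !JD !JN !BD !BD2 !BD3 !BD4 !BN !BN2 !BN3 !BN4 !h0 e1 e2 e3 e4 e5.
  move=> m1 m2; rewrite -[RHS](addr0 0) -{1}m1 -{1}m2; ring.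
move=> X Y; apply: reg2; apply: reg2; apply: reg2.
have := key X (J Y); have := key X Y.
rewrite (J2 X (J Y)) (J2 (J X)) JJ4 JJ !opprK => m1 m2.
have -> : 2 * (2 * (2 * B X Y X Y)) = 3 * (B X (J Y) X (J Y) + 3 * B X Y X Y)
    - (B X Y X Y + 3 * B X (J Y) X (J Y)) by ring.
by rewrite m1 m2 mulr0 subr0.
Qed.

End CurvatureLike.

(** * Tensor fields as maps linear over smooth functions *)

Section TensorLinearity.
Context {R : realType} {m : nat} {M : smoothManifold R m}.
Local Notation C := (smoothFun M).
Local Notation VF := (vectorField M).
Implicit Types (f : C) (X Y Z W : VF).

Lemma field_atP f X Y p :
  field_at (f *: X + Y) p = f p *: field_at X p + field_at Y p.
Proof. exact: val_inj. Qed.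

Lemma metric_appP (g : metric M) f X Y Z : g (f *: X + Y) Z = f * g X Z + g Y Z.
Proof. by apply: smoothFunP => p /=; rewrite field_atP metric_linear. Qed.

Lemma metric_appC (g : metric M) X Y : g X Y = g Y X.
Proof. by apply: smoothFunP => p /=; rewrite Defs.metric_sym. Qed.

Lemma form_appP (w : oneForm M) f X Y : w (f *: X + Y) = f * w X + w Y.
Proof. by apply: smoothFunP => p /=; rewrite field_atP linearP. Qed.

Lemma endo_appP (T : tensor11 M) f X Y : T (f *: X + Y) = f *: T X + T Y.
Proof.
apply: val_inj; apply/funext => h; apply: smoothFunP => p.
by rewrite -[LHS]/(endo_at T p (field_at (f *: X + Y) p) h) field_atP linearP.
Qed.

Section Metric.
Variable g : metric M.
Lemma metric_appDl X Y Z : g (X + Y) Z = g X Z + g Y Z.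
Proof. by have := metric_appP g 1 X Y Z; rewrite scale1r mul1r. Qed.
Lemma metric_app0l Z : g 0 Z = 0.
Proof. by apply: (addrI (g 0 Z)); rewrite -metric_appDl !addr0. Qed.
Lemma metric_appZl f X Z : g (f *: X) Z = f * g X Z.
Proof. by rewrite -[f *: X]addr0 metric_appP metric_app0l addr0. Qed.
Lemma metric_appNl X Z : g (- X) Z = - g X Z.
Proof. by rewrite -scaleN1r metric_appZl mulN1r. Qed.
Lemma metric_appDr X Y Z : g Z (X + Y) = g Z X + g Z Y.
Proof. by rewrite !(metric_appC g Z) metric_appDl. Qed.
Lemma metric_appZr f X Z : g Z (f *: X) = f * g Z X.
Proof. by rewrite !(metric_appC g Z) metric_appZl. Qed.
Lemma metric_appNr X Z : g Z (- X) = - g Z X.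
Proof. by rewrite !(metric_appC g Z) metric_appNl. Qed.
Definition metric_appE := (metric_appDl, metric_appZl, metric_appNl,
  metric_appDr, metric_appZr, metric_appNr).

Lemma metric_app_ext X Y : (forall W, g X W = g Y W) -> X = Y.
Proof.
move=> XY; apply/eqP; rewrite -subr_eq0; apply/eqP; apply: (@metric_app_inj _ _ _ g).
by move=> W; rewrite !metric_appE XY subrr.
Qed.
End Metric.

Section Form.
Variable w : oneForm M.
Lemma form_appD X Y : w (X + Y) = w X + w Y.
Proof. by have := form_appP w 1 X Y; rewrite scale1r mul1r. Qed.
Lemma form_appZ f X : w (f *: X) = f * w X.
Proof.
have w0 : w 0 = 0 by apply: (addrI (w 0)); rewrite -form_appD !addr0.
by rewrite -[f *: X]addr0 form_appP w0 addr0.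
Qed.
Lemma form_appN X : w (- X) = - w X.
Proof. by rewrite -scaleN1r form_appZ mulN1r. Qed.
Definition form_appE := (form_appD, form_appZ, form_appN).
End Form.

Section Endo.
Variable T : tensor11 M.
Lemma endo_appD X Y : T (X + Y) = T X + T Y.
Proof. by have := endo_appP T 1 X Y; rewrite !scale1r. Qed.
Lemma endo_appZ f X : T (f *: X) = f *: T X.
Proof.
have T0 : T 0 = 0 by apply: (addrI (T 0)); rewrite -endo_appD !addr0.
by rewrite -[f *: X]addr0 endo_appP T0 !addr0.
Qed.
Lemma endo_appN X : T (- X) = - T X.
Proof. by rewrite -scaleN1r endo_appZ scaleN1r. Qed.
Definition endo_appE := (endo_appD, endo_appZ, endo_appN).
End Endo.

Lemma field_appD X f h : X (f + h) = X f + X h.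
Proof. by have [] := vectorFieldP X. Qed.
Lemma field_appM X f h : X (f * h) = f * X h + h * X f.
Proof. by have [] := vectorFieldP X. Qed.
Lemma field_appC X a : X (cstC M a) = 0.
Proof.
have X1 : X 1 = 0.
  by apply: (addrI (X 1)); rewrite addr0 -[RHS]/(X 1) -{3}[1]mulr1 field_appM mul1r.
have [_ XZ _] := vectorFieldP X.
by rewrite -[cstC M a]mulr1 XZ X1 mulr0.
Qed.
Lemma field_appN X f : X (- f) = - X f.
Proof.
have X0 : X 0 = 0 by apply: (addrI (X 0)); rewrite -field_appD !addr0.
by apply: (addrI (X f)); rewrite -field_appD !subrr.
Qed.

Lemma smooth_natr n : (n%:R : C) = cstC M n%:R.
Proof.
elim: n => [|n IH]; first exact: smoothFunP.
by rewrite -natr1 IH; apply: smoothFunP => p /=; rewrite -natr1.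
Qed.

Lemma smooth_natr_reg n f : n.+1%:R * f = 0 -> f = 0.
Proof.
move=> nf; apply: smoothFunP => p; have := congr1 (fun k : C => k p) nf.
rewrite smooth_natr -[LHS]/(n.+1%:R * f p) => /eqP.
by rewrite mulf_eq0 pnatr_eq0 => /eqP.
Qed.

Lemma lie_jacobi X Y Z : lie_bracket (lie_bracket X Y) Z
  + lie_bracket (lie_bracket Y Z) X + lie_bracket (lie_bracket Z X) Y = 0.
Proof.
apply: val_inj; apply/funext => f.
rewrite -[LHS]/(lie_bracket (lie_bracket X Y) Z f + lie_bracket (lie_bracket Y Z) X f
  + lie_bracket (lie_bracket Z X) Y f) -[RHS]/(0 : C) /=.
rewrite !field_appD !field_appN; ring.
Qed.

End TensorLinearity.

(** * Symmetries of the curvature of a metric connection *)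

Section RiemannCurvature.
Context {R : realType} {m : nat} {M : smoothManifold R m}.
Local Notation C := (smoothFun M).
Local Notation VF := (vectorField M).
Variables (g : metric M) (nabla : VF -> VF -> VF).
Hypothesis LC : levi_civita g nabla.
Implicit Types (f : C) (X Y Z W : VF).

Lemma nablaDr X Y Z : nabla X (Y + Z) = nabla X Y + nabla X Z.
Proof. exact: nablaD LC _ _ _. Qed.
Lemma nablaZr X f Y : nabla X (f *: Y) = X f *: Y + f *: nabla X Y.
Proof. exact: nabla_leibniz LC _ _ _. Qed.
Lemma nablaNr X Y : nabla X (- Y) = - nabla X Y.
Proof.
have n0 : nabla X 0 = 0 by apply: (addrI (nabla X 0)); rewrite -nablaDr !addr0.
by apply: (addrI (nabla X Y)); rewrite -nablaDr !subrr.
Qed.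
Definition nablaEr := (nablaDr, nablaZr, nablaNr).
Lemma lieE X Y : lie_bracket X Y = nabla X Y - nabla Y X.
Proof. by rewrite (nabla_torsion_free LC). Qed.

Lemma curvature_skew12 X Y Z W :
  curvature4 g nabla Y X Z W = - curvature4 g nabla X Y Z W.
Proof.
have nl U V T : nabla (U + V) T = nabla U T + nabla V T.
  by have := nabla_linear LC 1 U V T; rewrite !scale1r.
have nlN U V : nabla (- U) V = - nabla U V.
  have n0 : nabla 0 V = 0 by apply: (addrI (nabla 0 V)); rewrite -nl !addr0.
  by apply: (addrI (nabla U V)); rewrite -nl !subrr.
rewrite /curvature4 /curvature !lieE !nl !nlN !metric_appE; ring.
Qed.

(** Both [X, Y] and X Y - Y X are applied to the function g(Z,W), and the second
    is expanded with the compatibility of the connection and the metric. *)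
Lemma curvature_skew34 X Y Z W :
  curvature4 g nabla X Y W Z = - curvature4 g nabla X Y Z W.
Proof.
have gm := nabla_metric LC.
have e1 := gm (lie_bracket X Y) Z W.
have e2 : lie_bracket X Y (g Z W) = X (Y (g Z W)) - Y (X (g Z W)) by [].
rewrite e2 (gm Y) (gm X Z W) !field_appD !gm in e1.
rewrite /curvature4 /curvature !metric_appE.
rewrite (metric_appC _ (nabla (lie_bracket X Y) W)).
rewrite (metric_appC _ (nabla X (nabla Y W))).
rewrite (metric_appC _ (nabla Y (nabla X W))).
apply/eqP; rewrite -addr_eq0; apply/eqP.
apply: (addrI (g (nabla (lie_bracket X Y) Z) W + g Z (nabla (lie_bracket X Y) W))).
rewrite addr0 -[RHS]e1; ring.
Qed.

(** Torsion-freeness turns the sum into a sum of double brackets, which is zero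
    by the Jacobi identity. *)
Lemma curvature_bianchi X Y Z W : curvature4 g nabla X Y Z W
  + curvature4 g nabla Y Z X W + curvature4 g nabla Z X Y W = 0.
Proof.
have e U V T : nabla (lie_bracket U V) T
    = nabla T (nabla U V) - nabla T (nabla V U) + lie_bracket (lie_bracket U V) T.
  by rewrite [lie_bracket (lie_bracket _ _) _]lieE {3}lieE !nablaEr [RHS]addrC subrK.
have := congr1 (fun U => g U W) (lie_jacobi X Y Z).
rewrite metric_app0l !metric_appE => J.
rewrite /curvature4 /curvature !e !metric_appE -[RHS]oppr0 -[in RHS]J; ring.
Qed.

End RiemannCurvature.

(** * Lorentzian trans-Sasakian manifolds *)

Section SpaceForm.
Context {R : realType} {m : nat} {M : smoothManifold R m}.
Local Notation C := (smoothFun M).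
Local Notation VF := (vectorField M).
Variables (phi : tensor11 M) (xi : VF) (eta : oneForm M) (g : metric M).
Variables (nabla : VF -> VF -> VF) (alpha beta c : R).
Local Notation a := (cstC M alpha).
Local Notation b := (cstC M beta).
Hypothesis HT : lorentzian_trans_sasakian phi xi eta g nabla a b.
Implicit Types (X Y Z W : VF).
Local Notation T := (curvature4 g nabla).

Let LC : levi_civita g nabla. Proof. exact: lts_levi_civita HT. Qed.
Let AC : almost_contact phi xi eta.
Proof. exact: lacm_almost_contact (lts_almost_contact_metric HT). Qed.
Let phi2 X : phi (phi X) = - X + eta X *: xi. Proof. exact: phi_sqr AC X. Qed.
Let phixi : phi xi = 0. Proof. exact: phi_xi AC. Qed.
Let etaphi X : eta (phi X) = 0. Proof. exact: eta_phi AC X. Qed.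
Let etaxi : eta xi = 1. Proof. exact: eta_xi AC. Qed.
Let gphiphi X Y : g (phi X) (phi Y) = g X Y + eta X * eta Y.
Proof. exact: lacm_compatible (lts_almost_contact_metric HT) X Y. Qed.

Lemma metric_xi X : g X xi = - eta X.
Proof.
have := gphiphi X xi; rewrite phixi metric_appC metric_app0l etaxi mulr1.
by move=> /eqP; rewrite eq_sym addr_eq0 => /eqP.
Qed.

Lemma metric_phi X Y : g X (phi Y) = - g (phi X) Y.
Proof.
have := gphiphi X (phi Y); rewrite etaphi mulr0 addr0 phi2 !metric_appE.
by rewrite metric_xi etaphi oppr0 mulr0 addr0 => <-.
Qed.

Lemma metric_phiC X Y : g (phi Y) X = - g (phi X) Y.
Proof. by rewrite metric_appC metric_phi. Qed.

Lemma nabla_phi X Y : nabla X (phi Y) = phi (nabla X Y)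
  + (a *: (eta Y *: X + g X Y *: xi) - b *: (eta Y *: phi X + g (phi X) Y *: xi)).
Proof. by rewrite -(lts_phi HT) /nabla_endo addrC subrK. Qed.

Lemma nabla_xi X : nabla X xi = a *: phi X + b *: (X - eta X *: xi).
Proof. exact: lts_xi HT X. Qed.

Lemma derive_eta X Y : X (eta Y) =
  eta (nabla X Y) - a * g (phi X) Y - b * (g X Y + eta X * eta Y).
Proof.
have := lts_eta HT X Y; rewrite /nabla_form metric_phi gphiphi => /eqP.
by rewrite subr_eq => /eqP ->; ring.
Qed.

Lemma curvature_xi X Y W : T X Y xi W =
  (a ^+ 2 - b ^+ 2) * (eta Y * g X W - eta X * g Y W)
  - 2 * a * b * (eta Y * g (phi X) W - eta X * g (phi Y) W).
Proof.
rewrite /curvature4 /curvature !(nabla_xi, nablaEr LC, nabla_phi).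
rewrite !field_appC !(endo_appE, metric_appE, form_appE, lieE LC, field_appM,
  field_appN).
rewrite !derive_eta (metric_phiC X Y) (metric_appC g Y X); ring.
Qed.


(** The Bianchi identity for (X, xi, Z), paired with xi, leaves
    4 alpha beta g(phi X, Z) = 0 by [curvature_xi]. *)
Lemma trans_sasakian_degenerate :
  alpha = 0 \/ beta = 0 \/ forall X, phi X = 0.
Proof.
have abw X Z : a * b * g (phi X) Z = 0.
  have := curvature_bianchi LC X xi Z xi.
  rewrite (curvature_skew34 LC X xi xi Z) (curvature_skew34 LC xi Z xi X).
  rewrite (curvature_skew34 LC Z X xi xi) !curvature_xi phixi !metric_app0l.
  rewrite (metric_appC g xi Z) (metric_appC g xi X) !metric_xi etaxi.
  rewrite !(metric_phiC X Z) !etaphi => e.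
  apply: (@smooth_natr_reg _ _ _ 3); rewrite -[RHS]e.
  rewrite (metric_appC g Z X). ring.
have [->|a0] := eqVneq alpha 0; first by left.
have [->|b0] := eqVneq beta 0; first by right; left.
right; right=> X; apply: (@metric_app_inj _ _ _ g) => Z; apply: smoothFunP => p.
have /(congr1 (fun k : C => k p)) := abw X Z.
rewrite -[LHS]/(alpha * beta * g (phi X) Z p) => /eqP.
by rewrite !mulf_eq0 (negbTE a0) (negbTE b0) => /eqP.
Qed.

(** The functions (nabla_X eta) Z and g ((nabla_X phi) Y, W). *)
Definition deta X Z : C := - a * g (phi X) Z - b * (g X Z + eta X * eta Z).
Definition dphi X Y W : C := a * (eta Y * g X W - g X Y * eta W)
  - b * (eta Y * g (phi X) W - g (phi X) Y * eta W).

(** The function g ((nabla_X P) (Y, Z), W) for the tensor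
    P (Y, Z) = (nabla_Y phi) Z, that is, the second covariant derivative of
    phi; note that g (nabla_X xi, W) = - [deta] X W. *)
Definition ddphi X Y Z W : C := a * (deta X Z * g Y W - g Y Z * deta X W)
  - b * (deta X Z * g (phi Y) W + eta Z * dphi X Y W - dphi X Y Z * eta W
         - g (phi Y) Z * deta X W).

(** The Ricci identity for phi: the commutator of R(X,Y) with phi is the
    skew part of the second covariant derivative of phi. *)
Lemma curvature_phi X Y Z W :
  T X Y (phi Z) W + T X Y Z (phi W) = ddphi X Y Z W - ddphi Y X Z W.
Proof.
rewrite /curvature4 /curvature !(nabla_xi, nablaEr LC, nabla_phi).
rewrite !field_appC !(endo_appE, metric_appE, form_appE, lieE LC, field_appM,
  field_appN, field_appD, nabla_metric LC).
rewrite !(nabla_xi, nablaEr LC, nabla_phi).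
rewrite !(endo_appE, metric_appE, form_appE) !derive_eta !metric_phi.
rewrite !(metric_appC g xi) !metric_xi.
rewrite /ddphi /dphi /deta; ring.
Qed.

Local Notation k1 := (3 * (a ^+ 2 - b ^+ 2) - cstC M c).
Local Notation k2 := (a ^+ 2 - b ^+ 2 + cstC M c).

(** The right-hand side of the theorem paired with W, without its term in
    alpha * beta. *)
Definition model X Y Z W : C :=
  k1 * (g X Z * g Y W - g Y Z * g X W)
  + k2 * (eta Z * (eta Y * g X W - eta X * g Y W)
          - (eta Y * g X Z - eta X * g Y Z) * eta W
          - g (phi X) Z * g (phi Y) W + g (phi Y) Z * g (phi X) W
          - 2 * g (phi X) Y * g (phi Z) W).

Definition defect X Y Z W : C := 4 * T X Y Z W - model X Y Z W.

Lemma defect_skew12 X Y Z W : defect Y X Z W = - defect X Y Z W.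
Proof.
by rewrite /defect /model (curvature_skew12 LC X Y) (metric_phiC X Y); ring.
Qed.

Lemma defect_skew34 X Y Z W : defect X Y W Z = - defect X Y Z W.
Proof.
by rewrite /defect /model (curvature_skew34 LC X Y Z) (metric_phiC Z W); ring.
Qed.

Lemma defect_bianchi X Y Z W :
  defect X Y Z W + defect Y Z X W + defect Z X Y W = 0.
Proof.
rewrite -[RHS](mulr0 4) -[in RHS](curvature_bianchi LC X Y Z W) /defect /model.
rewrite (metric_phiC X Y) (metric_phiC X Z) (metric_phiC Y Z).
by rewrite (metric_appC g Y X) (metric_appC g Z X) (metric_appC g Z Y); ring.
Qed.

Lemma curvature4P f X Y Z Z' W : T X Y (f *: Z + Z') W = f * T X Y Z W + T X Y Z' W.
Proof.
rewrite (curvature_skew34 LC X Y W) (curvature_skew34 LC X Y W Z).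
by rewrite (curvature_skew34 LC X Y W Z') /curvature4 !metric_appE; ring.
Qed.

Lemma defectP f X Y Z Z' W :
  defect X Y (f *: Z + Z') W = f * defect X Y Z W + defect X Y Z' W.
Proof.
by rewrite /defect curvature4P /model !(endo_appE, metric_appE, form_appE); ring.
Qed.

(** The hypothesis removes the part of R(X,Y)xi in alpha * beta. *)
Lemma defect_xi X Y W : alpha * beta = 0 \/ (forall U, phi U = 0) ->
  defect X Y xi W = 0.
Proof.
move=> ab.
have ab0 U V : a * b * g (phi U) V = 0.
  case: ab => [ab|->]; last by rewrite metric_app0l mulr0.
  have -> : a * b = 0 by apply: smoothFunP => p; rewrite -[LHS]/(alpha * beta) ab.
  by rewrite mul0r.
rewrite /defect curvature_xi /model phixi !metric_app0l !metric_xi etaxi.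
transitivity (8 * eta X * (a * b * g (phi Y) W) - 8 * eta Y * (a * b * g (phi X) W)).
  by rewrite !etaphi; ring.
by rewrite !ab0 !mulr0 subr0.
Qed.

(** If alpha or beta is zero, this is an identity between the explicit
    expressions in [curvature_phi] and [curvature_xi].  If phi = 0, every field
    is a multiple of xi and both sides vanish. *)
Lemma defect_phi X Y Z W : defect X Y (phi Z) (phi W) = defect X Y Z W.
Proof.
have [H|nd] : (alpha = 0 \/ beta = 0) \/ (forall U, phi U = 0).
- by case: trans_sasakian_degenerate => [|[]]; auto.
- have e : T X Y (phi Z) (phi W) = T X Y Z W + eta W * T X Y xi Z
    + ddphi X Y Z (phi W) - ddphi Y X Z (phi W).
    have e1 : T X Y Z (phi (phi W)) = - T X Y Z W - eta W * T X Y xi Z.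
      have x := curvature_skew34 LC X Y xi Z.
      by rewrite /curvature4 in x *;
        rewrite phi2 metric_appDr metric_appNr metric_appZr x; ring.
    have := curvature_phi X Y Z (phi W); rewrite e1 => H1.
    apply: (addIr (- T X Y Z W - eta W * T X Y xi Z)); rewrite H1; ring.
  rewrite /defect e curvature_xi /model /ddphi /dphi /deta.
  rewrite !metric_phi !etaphi !phi2 !(endo_appE, metric_appE, form_appE).
  rewrite !(metric_appC g xi) !metric_xi !etaphi.
  case: H => ->.
    have -> : cstC M 0 = 0 by exact: smoothFunP.
    ring.
  have -> : cstC M 0 = 0 by exact: smoothFunP.
  ring.
have X0 U : U = eta U *: xi.
  by have := phi2 U; rewrite !nd => /eqP; rewrite eq_sym addrC subr_eq0 => /eqP.
have D0 V : defect X Y 0 V = 0.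
  apply: (addrI (defect X Y 0 V)); rewrite addr0.
  by have := defectP 1 X Y 0 0 V; rewrite scale1r addr0 mul1r => <-.
have D U V : defect X Y U V = 0.
  rewrite (X0 U) -[_ *: xi]addr0 defectP D0 addr0 defect_xi ?mulr0//.
  by right.
by rewrite !D.
Qed.

Lemma defect_pair X Y Z W : defect X Y Z W = defect Z W X Y.
Proof.
apply: pair_symmetry; [|exact: defect_skew12|exact: defect_skew34|
  exact: defect_bianchi].
exact: (@smooth_natr_reg _ _ _ 1).
Qed.

Hypothesis HC : constant_phi_sectional_curvature phi xi g nabla c.

(** The value of [model] at (X, phi X, X, phi X) is - 4 c g(X,X)^2, because the
    parts of its two coefficients in alpha and beta cancel. *)
Lemma defect_horizontal X : g X xi = 0 -> defect X (phi X) X (phi X) = 0.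
Proof.
move=> Xxi; have eX : eta X = 0 by rewrite -[eta X]opprK -metric_xi Xxi oppr0.
have w0 : g (phi X) X = 0.
  apply: (@smooth_natr_reg _ _ _ 1); rewrite -[2%:R]/(1 + 1 : C) mulrDl mul1r.
  by rewrite -{1}[g _ X]opprK -metric_phiC addNr.
rewrite /defect (HC Xxi) /model !metric_phi !phi2 !(metric_appE, etaphi) eX w0.
ring.
Qed.

(** The hypothesis of [holomorphic_sectional_eq0] holds for every field, not
    only for those orthogonal to xi, because [defect] depends on the horizontal
    part of its arguments only. *)
Lemma defect_eq0 X Y Z W : defect X Y Z W = 0.
Proof.
have dP f U U' V V' V'' : defect (f *: U + U') V V' V''
    = f * defect U V V' V'' + defect U' V V' V''.
  by rewrite defect_pair defectP -!(defect_pair _ V V' V'').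
have xi3 U V V' : defect U V xi V' = 0.
  apply: defect_xi; case: trans_sasakian_degenerate => [->|[->|]];
    rewrite ?mul0r ?mulr0; auto.
have xi1 U V V' : defect xi U V V' = 0 by rewrite defect_pair.
have dD U U' V V' V'' :
    defect (U + U') V V' V'' = defect U V V' V'' + defect U' V V' V''.
  by have := dP 1 U U' V V' V''; rewrite scale1r mul1r.
apply: (@holomorphic_sectional_eq0 _ _ defect _ _ _ _ _ _ phi).
- exact: (@smooth_natr_reg _ _ _ 1).
- exact: dD.
- exact: defect_skew12.
- exact: defect_skew34.
- exact: defect_bianchi.
- exact: (@smooth_natr_reg _ _ _ 2).
- exact: endo_appD.
- move=> {X Y Z W} X Y Z W; rewrite phi2 addrC dP xi1 mulr0 add0r.
  apply: (addrI (defect X Y Z W)); rewrite -dD !subrr.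
  by apply: (addrI (defect 0 Y Z W)); rewrite -dD !addr0.
- exact: defect_phi.
move=> {X Y Z W} X; pose H := X - eta X *: xi.
have XH : X = eta X *: xi + H by rewrite addrC subrK.
have HH : g H xi = 0.
  by rewrite /H !metric_appE !metric_xi etaxi; ring.
have pH : phi X = phi H by rewrite {1}XH endo_appP phixi scaler0 add0r.
have hE V V' : defect X V X V' = defect H V H V'.
  by rewrite {1 2}XH dP xi1 mulr0 add0r defectP xi3 mulr0 add0r.
by rewrite hE pH; exact: defect_horizontal.
Qed.
End SpaceForm.

Theorem theorem3p4 (R : realType) (n : nat)
    (M : smoothManifold R (2 * n).+1)
    (phi : tensor11 M) (xi : vectorField M) (eta : oneForm M) (g : metric M)
    (nabla : vectorField M -> vectorField M -> vectorField M)
    (alpha beta c : R)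
    (HM : lorentzian_trans_sasakian_space_form phi xi eta g nabla
            (cstC M alpha) (cstC M beta) c)
    (X Y Z : vectorField M) :
  4 *: curvature nabla X Y Z =
    cstC M (3 * (alpha ^+ 2 - beta ^+ 2) - c) *: (g X Z *: Y - g Y Z *: X)
    + cstC M (alpha ^+ 2 - beta ^+ 2 + c) *:
        (eta Z *: (eta Y *: X - eta X *: Y)
         + (eta Y * g X Z - eta X * g Y Z) *: xi
         + g X (phi Z) *: phi Y - g Y (phi Z) *: phi X
         + (2 * g X (phi Y)) *: phi Z)
    + cstC M (8 * alpha * beta) *:
        ((eta X * g Y (phi Z) - eta Y * g X (phi Z)) *: xi
         + eta Z *: (eta X *: phi Y - eta Y *: phi X)).
Proof.
have [HT HC] := HM.
apply: (@metric_app_ext _ _ _ g) => W.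
have := defect_eq0 HT HC X Y Z W; rewrite /defect /model => /eqP.
rewrite subr_eq0 metric_appZl -/(curvature4 g nabla X Y Z W) => /eqP ->.
have abphi (U V : vectorField M) : cstC M (8 * alpha * beta) * g (phi U) V = 0.
  case: (trans_sasakian_degenerate HT) => [->|[->|->]]; last first.
  - by rewrite metric_app0l mulr0.
  - by rewrite mulr0; apply: smoothFunP => p; exact: mul0r.
  - by rewrite mulr0 mul0r; apply: smoothFunP => p; exact: mul0r.
have -> : cstC M (3 * (alpha ^+ 2 - beta ^+ 2) - c)
    = 3 * (cstC M alpha ^+ 2 - cstC M beta ^+ 2) - cstC M c by exact: smoothFunP.
have -> : cstC M (alpha ^+ 2 - beta ^+ 2 + c)
    = cstC M alpha ^+ 2 - cstC M beta ^+ 2 + cstC M c by exact: smoothFunP.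
rewrite !metric_appE !(metric_phi HT) (metric_appC g xi) !(metric_xi HT).
rewrite [X in _ = _ + X](_ : _ =
    eta X * eta W * (cstC M (8 * alpha * beta) * g (phi Y) Z)
    - eta Y * eta W * (cstC M (8 * alpha * beta) * g (phi X) Z)
    + eta Z * eta X * (cstC M (8 * alpha * beta) * g (phi Y) W)
    - eta Z * eta Y * (cstC M (8 * alpha * beta) * g (phi X) W)); last by ring.
by rewrite !abphi; ring.
Qed.
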